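(* Let $K$ be a field of characteristic $p>0$, $n\ge1$, and $\underline f=(f_1,\dots,f_n)\in K^n$ with $\Delta_n(\underline f)\neq0$. Let $A:=K[W_k,1\le k\le n]/(W_k^p-W_k-f_k)_{1\le k\le n}$, $w_i$ the image of $W_i$ in $A$, and $w\in A$, $Q\in K[W]$ as in the context, so that $A=K[w]\simeq K[W]/(Q(W))$ (with $w$ corresponding to the class of $W$). Let $\mathcal F:=\bigoplus_{i=1}^n\mathbb{F}_pf_i$ and $Z:=\bigoplus_{i=1}^n\mathbb{F}_p\Delta_{n-1}(\underline{\hat f_i})$, two $\mathbb{F}_p$-subspaces of $K$. (1) For $z\in Z$ let $\sigma_z$ be the $K$-algebra automorphism of $K[W]$ with $\sigma_z(W)=W+z$. Then $\sigma_z$ induces a $K$-algebra automorphism of $A$, still denoted $\sigma_z$. The map $z\in Z\mapsto\sigma_z\in\operatorname{Aut}_KA$ is an injective group homomorphism, and its image is a subgroup $G$ of $\operatorname{Aut}_KA$ isomorphic to $(\mathbb{Z}/p\mathbb{Z})^n$. (2) Let $U:=(Z/\Delta_n(\underline f))^p=\{(z/\Delta_n(\underline f))^p: z\in Z\}\subset K$, the $\mathbb{F}_p$-space of roots of the reversed polynomial of $P_{\mathcal F}(X):=\prod_{x\in\mathcal F}(X-x)$. Let $z\in Z$ and write $z=\Delta_n(\underline f)u^{1/p}$ with $u\in U$. For $\underline\epsilon=(\epsilon_1,\dots,\epsilon_n)\in\mathbb{F}_p^n\setminus\{(0,\dots,0)\}$ let $w_{\underline\epsilon}:=\sum_{i}\epsilon_iw_i\in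 A$ and $f_{\underline\epsilon}:=\sum_i\epsilon_if_i\in K$. Then $w_{\underline\epsilon}^p-w_{\underline\epsilon}=f_{\underline\epsilon}$, and $K[w_{\underline\epsilon}]\subset A$ is isomorphic to the $K$-algebra $K[W_{\underline\epsilon}]/(W_{\underline\epsilon}^p-W_{\underline\epsilon}-f_{\underline\epsilon})$, hence is a $K$-subalgebra of dimension $p$. Moreover $$\sigma_z(w_{\underline\epsilon})=w_{\underline\epsilon}+(-1)^{n-1}E(f_{\underline\epsilon},u),$$ where $E:\mathcal F\times U\to\mathbb{F}_p$ is the Elkies pairing. (3) Let $r$ be the dimension of the $\mathbb{F}_p$-vector space $\big((\sum_i\mathbb{F}_pf_i)+\{x^p-x:x\in K\}\big)/\{x^p-x:x\in K\}$. When $r=n$, i.e. when $A$ is a field and $G$ is the full group $\operatorname{Aut}_KA$, the set $\{K[w_{\underline\epsilon}] : \underline\epsilon\in\mathcal{E}\}$, where $\mathcal{E}$ is a set of representatives of $\mathbb{P}^{n-1}(\mathbb{F}_p)$, is equal to the set of the $\frac{p^n-1}{p-1}$ $p$-cyclic extensions of $K$ inside $A$.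
   Context: Here $q=p$. For $\underline a=(a_1,\dots,a_n)$ in a commutative ring containing $\mathbb{F}_p$, $\Delta_n(\underline a):=\det\big(a_j^{p^{i-1}}\big)_{1\le i,j\le n}$ is the Moore determinant, with $\Delta_0:=1$. $\underline{\hat f_i}:=(f_1,\dots,f_{i-1},f_{i+1},\dots,f_n)$. The element $w\in A$ is the determinant of the $n\times n$ matrix whose first row is $(w_1,\dots,w_n)$ and whose following rows are $(f_1^{p^k},\dots,f_n^{p^k})$ for $0\le k\le n-2$; equivalently $w=\sum_{i=1}^n(-1)^{i-1}\Delta_{n-1}(\underline{\hat f_i})\,w_i$. The polynomial $Q$ is $$Q(W)=\frac{\Delta_{n+1}(\Delta_{n-1}(\underline{\hat f_1}),\dots,\Delta_{n-1}(\underline{\hat f_n}),W)}{\Delta_n(\Delta_{n-1}(\underline{\hat f_1}),\dots,\Delta_{n-1}(\underline{\hat f_n}))}-\Delta_n(\underline f)^{p^{n-1}},$$ and it is known that $A=K[w]$ with $A\simeq K[W]/(Q(W))$. Write $P_{\mathcal F}(X)=\sum_{m=0}^nc_mX^{p^m}$ with $c_n=1$; its reversed polynomial is $\sum_{m=0}^nc_{n-m}^{p^m}X^{p^m}$, whose set of roots is $U$ (known). The Elkies pairing is $$E(x,u):=\sum_{m=1}^n\sum_{j=0}^{m-1}\big((c_mu)^{p^{-m}}x\big)^{p^j}\in\mathbb{F}_p\qquad(x\in\mathcal F,\ u\in U),$$ where $p^{m}$-th roots are taken in an algebraic closure of $K$ (it is known that the value lies in $\mathbb{F}_p$). *)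

(* Defs.v *)
From HB Require Import structures.
From mathcomp Require Import all_boot all_order all_algebra all_fingroup.
From mathcomp Require Import all_solvable all_field.
From mathcomp Require Import mpoly boolp.

Set Implicit Arguments.
Unset Strict Implicit.
Unset Printing Implicit Defensive.

Import GRing.Theory.
Local Open Scope ring_scope.
Local Open Scope quotient_scope.

Definition moore (R : comNzRingType) (p n : nat) (a : 'I_n -> R) : R :=
  \det (\matrix_(i < n, j < n) a j ^+ (p ^ i)).

Definition hat_moore (R : comNzRingType) (p n : nat) (f : 'I_n -> R)
    (i : 'I_n) : R :=
  moore p (fun j : 'I_n.-1 => f (lift i j)).

Definition Fp_comb (V : zmodType) (p n : nat) (eps : 'rV['F_p]_n)
    (v : 'I_n -> V) : V :=
  \sum_i v i *+ (eps 0 i).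

Definition Fp_span (V : zmodType) (p n : nat) (v : 'I_n -> V) : seq V :=
  undup [seq Fp_comb eps v | eps : 'rV['F_p]_n].

Section ArtinSchreierAlgebra.
Variables (K : fieldType) (p : nat).

Definition AS_rel n (f : 'I_n -> K) (k : 'I_n) : {mpoly K[n]} :=
  'X_k ^+ p - 'X_k - (f k)%:MP.

(* Having p prime as an argument is what makes the ideal provably proper, as
   {ideal_quot _} requires. *)
Definition AS_ideal (pcharK : p \in [pchar K]) n (f : 'I_n -> K) :
    {pred {mpoly K[n]}} :=
  fun g => `[< exists h : 'I_n -> {mpoly K[n]}, g = \sum_k h k * AS_rel f k >].

Fact AS_model (p_gt1 : (1 < p)%N) n (f : 'I_n -> K) :
  exists (C : comNzRingType) (phi : {rmorphism K -> C}) (c : 'I_n -> C),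
    forall k, c k ^+ p - c k - phi (f k) = 0.
Proof.
elim: n f => [|n IHn] f.
  by exists K, idfun, (fun=> 0) => -[].
have [C [phi [c cP]]] := IHn (fun k => f (lift ord0 k)).
pose h : {poly C} := 'X^p - ('X + (phi (f ord0))%:P).
have sX : (size ('X + (phi (f ord0))%:P)%R < size ('X^p : {poly C}))%N.
  by rewrite size_XaddC size_polyXn.
have sh : size h = p.+1 by rewrite /h size_polyDl ?size_polyN // size_polyXn.
have mh : h \is monic.
  by rewrite monicE /h lead_coefDl ?size_polyN // lead_coefXn.
exists {poly %/ h}, (qpolyC h \o phi),
  (fun k => if unlift ord0 k is Some j then qpolyC h (c j) else 'qX).
move=> k; case: unliftP => [j|] -> /=.
  by rewrite -rmorphXn -!rmorphB cP rmorph0.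
have -> : qpolyC h (phi (f ord0)) = in_qpoly h (phi (f ord0))%:P.
  apply/val_inj; rewrite /= Pdiv.CommonRing.rmodp_small //.
  by rewrite (leq_ltn_trans (size_polyC_leq1 _)) // size_mk_monic_gt1.
rewrite /qpolyX -rmorphXn -!rmorphB -addrA -opprD -/h.
apply/val_inj => /=.
by rewrite /mk_monic sh ltnS (ltnW p_gt1) mh /= Pdiv.RingMonic.rmodpp.
Qed.

Fact AS_ideal_closed (pcharK : p \in [pchar K]) n (f : 'I_n -> K) :
  idealr_closed (AS_ideal pcharK f).
Proof.
split.
- by apply/asboolP; exists (fun=> 0); rewrite big1 // => k _; rewrite mul0r.
- apply/asboolP => -[h]; move/prime_gt1: (pcharf_prime pcharK) => p_gt1.
  have [C [phi [c cP]]] := AS_model p_gt1 f.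
  move/(congr1 (mmap phi c)); rewrite rmorph1 rmorph_sum big1 => [/eqP|k _].
    by rewrite oner_eq0.
  rewrite rmorphM /AS_rel !rmorphB rmorphXn /= mmapX mmap1U mmapC cP.
  by rewrite mulr0.
- move=> a g g' /asboolP[h ->] /asboolP[h' ->]; apply/asboolP.
  exists (fun k => a * h k + h' k); rewrite mulr_sumr -big_split /=.
  by apply: eq_bigr => k _; rewrite mulrDl mulrA.
Qed.

HB.instance Definition _ (pcharK : p \in [pchar K]) n (f : 'I_n -> K) :=
  isIdealr.Build {mpoly K[n]} (AS_ideal pcharK f) (AS_ideal_closed pcharK f).

Definition AS_alg (pcharK : p \in [pchar K]) n (f : 'I_n -> K) : Type :=
  {ideal_quot (AS_ideal pcharK f)}.

HB.instance Definition _ (pcharK : p \in [pchar K]) n (f : 'I_n -> K) :=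
  GRing.ComNzRing.on (AS_alg pcharK f).

Variables (pcharK : p \in [pchar K]) (n : nat) (f : 'I_n -> K).
Local Notation A := (AS_alg pcharK f).

Definition AS_pi (g : {mpoly K[n]}) : A :=
  \pi_{ideal_quot (AS_ideal pcharK f)} g.

Definition AS_scale (k : K) (a : A) : A := AS_pi k%:MP * a.

Let AS_piD : {morph AS_pi : g h / g + h}. Proof. exact: rmorphD. Qed.
Let AS_piM : {morph AS_pi : g h / g * h}. Proof. exact: rmorphM. Qed.
Let AS_pi1 : AS_pi 1 = 1. Proof. exact: rmorph1. Qed.

Fact AS_scaleA a b v : AS_scale a (AS_scale b v) = AS_scale (a * b) v.
Proof. by rewrite /AS_scale mpolyCM AS_piM mulrA. Qed.
Fact AS_scale1 : left_id 1 AS_scale.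
Proof. by move=> v; rewrite /AS_scale mpolyC1 AS_pi1 mul1r. Qed.
Fact AS_scaleDr : right_distributive AS_scale +%R.
Proof. by move=> a u v; rewrite /AS_scale mulrDr. Qed.
Fact AS_scaleDl v : {morph AS_scale^~ v : a b / a + b}.
Proof. by move=> a b; rewrite /AS_scale mpolyCD AS_piD mulrDl. Qed.

HB.instance Definition _ := GRing.Zmodule_isLmodule.Build K A
  AS_scaleA AS_scale1 AS_scaleDr AS_scaleDl.

Fact AS_scaleAl (k : K) (u v : A) : k *: (u * v) = k *: u * v.
Proof. exact: mulrA. Qed.

HB.instance Definition _ := GRing.Lmodule_isLalgebra.Build K A AS_scaleAl.
HB.instance Definition _ := GRing.Lalgebra_isComAlgebra.Build K A.

Definition AS_gen (k : 'I_n) : A := AS_pi 'X_k.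

Definition AS_w : A :=
  \det (\matrix_(i < n, j < n)
          if (i : nat) == 0%N then AS_gen j else (f j ^+ (p ^ i.-1))%:A).

End ArtinSchreierAlgebra.

Definition AS_Q (K : fieldType) (p n : nat) (f : 'I_n -> K) : {poly K} :=
  (moore p (hat_moore p f))^-1 *:
    moore p (fun j : 'I_n.+1 =>
               if unlift ord_max j is Some i then (hat_moore p f i)%:P else 'X)
  - (moore p f ^+ (p ^ n.-1))%:P.

Section Subalgebras.
Variables (K : fieldType) (A : comAlgType K).

Definition is_subalg (V : A -> Prop) : Prop :=
  [/\ V 1, forall (k : K) a b, V a -> V b -> V (k *: a + b)
    & forall a b, V a -> V b -> V (a * b)].

Definition gen_alg (a : A) : A -> Prop :=
  fun b => exists g : {poly K}, b = horner_alg a g.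

(* {poly %/ h} is K[W]/(h) for h monic and nonconstant; 'qX is the class of W
   (the library replaces any other h by 'X). *)
Definition quot_iso (h : {poly K}) (V : A -> Prop) (a : A) : Prop :=
  exists phi : {lrmorphism {poly %/ h} -> A},
    [/\ injective phi, forall b, V b <-> exists q, b = phi q & phi 'qX = a].

Definition has_Kdim (V : A -> Prop) (d : nat) : Prop :=
  exists b : 'I_d -> A, (forall i, V (b i)) /\
    forall a, V a -> exists! c : 'rV[K]_d, a = \sum_i c 0 i *: b i.

Definition is_field : Prop := forall a : A, a != 0 -> exists b, a * b = 1.

Definition is_Kaut (s : A -> A) : Prop :=
  bijective s /\ exists phi : {lrmorphism A -> A}, s =1 phi.

Definition is_Kaut_subgroup (G : (A -> A) -> Prop) : Prop :=
  [/\ forall s, G s -> is_Kaut s, G id,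
      forall s t, G s -> G t -> G (s \o t)
    & forall s t, G s -> cancel s t -> cancel t s -> G t].

Definition iso_Zp_pow (p n : nat) (G : (A -> A) -> Prop) : Prop :=
  exists theta : 'rV['Z_p]_n -> A -> A,
    [/\ forall s, G s <-> exists v, s =1 theta v,
        forall v v', theta (v + v') =1 theta v \o theta v'
      & forall v v', theta v =1 theta v' -> v = v'].

Definition is_pcyclic_ext (p : nat) (V : A -> Prop) : Prop :=
  exists (E : splittingFieldType K) (phi : {lrmorphism E -> A}),
    [/\ forall a, V a <-> exists x, a = phi x, galois 1%AS {:E},
        cyclic 'Gal({:E} / 1%AS) & #|'Gal({:E} / 1%AS)%g| = p].

Definition has_card (P : (A -> Prop) -> Prop) (N : nat) : Prop :=
  exists s : 'I_N -> A -> Prop, (forall i, P (s i)) /\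
    forall V, P V -> exists! i, forall a, V a <-> s i a.

End Subalgebras.

Section Elkies.
Variables (K : fieldType) (p n : nat) (f : 'I_n -> K).

Definition span_poly : {poly K} := \prod_(x <- Fp_span p f) ('X - x%:P).

(* span_poly is an additive polynomial: its only monomials are the 'X^(p ^ m)
   with m <= n, so these are the c_m of span_poly = \sum_m c_m X^(p^m). *)
Definition span_coef (m : nat) : K := span_poly`_(p ^ m).

Definition rev_span_poly : {poly K} :=
  \sum_(m < n.+1) (span_coef (n - m) ^+ (p ^ m)) *: 'X^(p ^ m).

Definition spaceU : seq K :=
  [seq (z / moore p f) ^+ p | z <- Fp_span p (hat_moore p f)].

Fact closed_root_subproof (L : closedFieldType) (d : nat) (x : L) :
  exists y, (0 < d)%N ==> (y ^+ d == x).
Proof.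
case: d => [|d]; first by exists 0.
have [y yP] := @solve_monicpoly L d.+1 (fun i => if i is 0%N then x else 0) isT.
by exists y; rewrite yP big_ord_recl big1 ?expr0 ?mulr1 ?addr0 //= => i _;
  rewrite mul0r.
Qed.

(* A d-th root; it is unique when d is a power of the characteristic. *)
Definition closed_root (L : closedFieldType) (d : nat) (x : L) : L :=
  xchoose (closed_root_subproof d x).

(* The formula takes its value in L; for x in the span of f and u in spaceU
   that value lies in the prime field. *)
Definition elkies (L : closedFieldType) (iota : K -> L) (x u : K) : L :=
  \sum_(1 <= m < n.+1) \sum_(j < m)
    (closed_root (p ^ m) (iota (span_coef m * u)) * iota x) ^+ (p ^ j).

End Elkies.

Definition is_alg_closure (K : fieldType) (L : closedFieldType)
    (iota : K -> L) : Prop :=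
  forall x : L, algebraicOver iota x.

(* dim_{F_p} (V / W) = r, for W <= V additive subgroups of K. *)
Definition has_Fp_quot_dim (K : fieldType) (p : nat) (V W : K -> Prop)
    (r : nat) : Prop :=
  exists b : 'I_r -> K, (forall i, V (b i)) /\
    forall x, V x -> exists! c : 'rV['F_p]_r, W (x - Fp_comb c b).

Definition AS_image (K : fieldType) (p : nat) (y : K) : Prop :=
  exists x, y = x ^+ p - x.

Definition proj_reps (p n : nat) (E : {set 'rV['F_p]_n}) : Prop :=
  0 \notin E /\
  forall v, v != 0 ->
    exists! e, e \in E /\ exists2 c : 'F_p, c != 0 & v = c *: e.

(* Main.v *)
Require Import Defs.
From HB Require Import structures.
From mathcomp Require Import all_boot all_order all_algebra all_fingroup.
From mathcomp Require Import all_solvable all_field.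
From mathcomp Require Import mpoly boolp zify.

Set Implicit Arguments.
Unset Strict Implicit.
Unset Printing Implicit Defensive.

Import GRing.Theory.
Local Open Scope ring_scope.

(* Up to sign, the hatted Moore determinants are the cofactors of the last row
   of the Moore matrix of [f], so the sums [sum_j c_j^(p^k) f_j^(p^i)] over the
   signed cofactors [c_j] vanish for [k <= i < k + n - 1].  As
   [w = sum_j c_j w_j] and [w_j^p = w_j + f_j], each [w^(p^k)] is, up to a
   constant, the combination of the [w_j] with coefficients [c_j^(p^k)]:
   inverting the Moore matrix of the [c_j] expresses the [w_j] in [w], and the
   equation for [k = n] is [Q(w) = 0].  The automorphisms [w_j |-> w_j + a_j],
   for [a] in [F_p^n], translate [w] by the elements of [Z].  If [g] kills [w],
   so does [g(X + z) - g], hence a nonzero [g] of least degree takes the same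
   value on all of [Z] and has degree at least [p^n]: [Q] generates the
   annihilator of [w].

   The [p^n]-th power of the Elkies pairing involves no roots.  On the families
   [f_i] and [(c_k / Delta)^p] its matrix is a product of two square matrices
   whose product in the other order is scalar by the vanishing above, so the
   pairing is [(-1)^(n-1)] times the standard dot product.  As its values are
   fixed by Frobenius, telescoping [E^p - E] shows that the elements of [U] are
   the roots of the reversed polynomial.

   Both [Q] and [X^p - X - f_eps] differ by a constant from an additive
   polynomial split over [K], so a root of an irreducible factor [g] of one of
   them generates a Galois extension of degree [deg g].  If no nonzero [f_eps]
   has the form [x^p - x] and [g] divides [Q], then the Galois group moves the
   images of the [w_j] by a subgroup of [F_p^n] that no nonzero linear form
   annihilates, that is, by all of [F_p^n]; so [deg g = p^n] and [A] is a field.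
   A [p]-cyclic subextension then has an Artin-Schreier generator [y]; the
   shifts move [y] by a linear form [a |-> a . eps], and [y - w_eps], being
   invariant, lies in [K]. *)

(** * Frobenius powers and combinations over the prime field *)

Section PcharExponent.
Variables (R : comNzRingType) (q : nat) (q_pchar : [pchar R].-nat q).

Definition pFrobenius_exp (_ : [pchar R].-nat q) (x : R) : R := x ^+ q.

Fact pFrobenius_exp_is_nmod_morphism : nmod_morphism (pFrobenius_exp q_pchar).
Proof.
split=> [|x y]; last exact: exprDn_pchar.
by case/andP: q_pchar => q_gt0 _; rewrite /pFrobenius_exp expr0n eqn0Ngt q_gt0.
Qed.

Fact pFrobenius_exp_is_monoid_morphism :
  monoid_morphism (pFrobenius_exp q_pchar).
Proof. by split=> [|x y]; rewrite /pFrobenius_exp ?expr1n ?exprMn. Qed.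

HB.instance Definition _ := GRing.isNmodMorphism.Build R R
  (pFrobenius_exp q_pchar) pFrobenius_exp_is_nmod_morphism.
HB.instance Definition _ := GRing.isMonoidMorphism.Build R R
  (pFrobenius_exp q_pchar) pFrobenius_exp_is_monoid_morphism.

Lemma exprBn_pchar (x y : R) : (x - y) ^+ q = x ^+ q - y ^+ q.
Proof. exact: (rmorphB (pFrobenius_exp q_pchar)). Qed.

Lemma expr0n_pchar : 0 ^+ q = 0 :> R.
Proof. exact: (rmorph0 (pFrobenius_exp q_pchar)). Qed.

Lemma expr_sum_pchar (I : Type) (r : seq I) (P : pred I) (F : I -> R) :
  (\sum_(i <- r | P i) F i) ^+ q = \sum_(i <- r | P i) F i ^+ q.
Proof. exact: (rmorph_sum (pFrobenius_exp q_pchar)). Qed.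

Lemma expr_nat_pchar m : (m%:R : R) ^+ q = m%:R.
Proof. exact: (rmorph_nat (pFrobenius_exp q_pchar)). Qed.

Lemma expr_sign_pchar m : ((-1) ^+ m : R) ^+ q = (-1) ^+ m.
Proof. exact: (rmorph_sign (pFrobenius_exp q_pchar)). Qed.

Lemma expr_det_pchar m (M : 'M[R]_m) :
  (\det M) ^+ q = \det (map_mx (fun x => x ^+ q) M).
Proof. exact/esym/(det_map_mx (pFrobenius_exp q_pchar)). Qed.

End PcharExponent.

Lemma expr_inj_pchar (R : idomainType) q :
  [pchar R].-nat q -> injective (fun x : R => x ^+ q).
Proof.
move=> q_pchar x y /= /eqP; rewrite -subr_eq0 -exprBn_pchar //.
by rewrite expf_eq0 subr_eq0 => /andP[_ /eqP].
Qed.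

Section PcharNat.
Variables (R : nzSemiRingType) (p : nat) (pcharR : p \in [pchar R]).

Lemma pchar_nat : [pchar R].-nat p.
Proof.
by rewrite (eq_pnat _ (pcharf_eq pcharR)) pnat_id ?(pcharf_prime pcharR).
Qed.

Lemma pchar_natX k : [pchar R].-nat (p ^ k)%N.
Proof. by rewrite pnatX pchar_nat. Qed.

End PcharNat.

Lemma AS_operatorD (R : comNzRingType) (p : nat) : p \in [pchar R] ->
  {morph (fun x : R => x ^+ p - x) : x y / x + y}.
Proof.
by move=> pcharR x y; rewrite exprDn_pchar ?pchar_nat // opprD addrACA.
Qed.

Section PrimeFieldScalars.
Variables (R : nzRingType) (p : nat) (pcharR : p \in [pchar R]).

Definition natrFp (_ : p \in [pchar R]) (c : 'F_p) : R := (c : nat)%:R.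

Lemma natrFp_nat m : natrFp pcharR m%:R = m%:R.
Proof.
rewrite /natrFp val_Fp_nat ?(pcharf_prime pcharR) //.
by rewrite (GRing.natr_mod_pchar pcharR).
Qed.

Fact natrFp_is_nmod_morphism : nmod_morphism (natrFp pcharR).
Proof.
split=> [|c d]; first by rewrite -[0]/(0%:R) natrFp_nat.
by rewrite -{1}[c]natr_Zp -{1}[d]natr_Zp -natrD natrFp_nat natrD.
Qed.

Fact natrFp_is_monoid_morphism : monoid_morphism (natrFp pcharR).
Proof.
split=> [|c d]; first by rewrite -[1]/(1%:R) natrFp_nat.
by rewrite -{1}[c]natr_Zp -{1}[d]natr_Zp -natrM natrFp_nat natrM.
Qed.

HB.instance Definition _ :=
  GRing.isNmodMorphism.Build 'F_p R (natrFp pcharR) natrFp_is_nmod_morphism.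
HB.instance Definition _ :=
  GRing.isMonoidMorphism.Build 'F_p R (natrFp pcharR) natrFp_is_monoid_morphism.

Lemma Fp_combE n (eps : 'rV['F_p]_n) (v : 'I_n -> R) :
  Fp_comb eps v = \sum_i natrFp pcharR (eps 0 i) * v i.
Proof. by apply: eq_bigr => i _; rewrite mulr_natl. Qed.

Lemma Fp_comb0 n (v : 'I_n -> R) : Fp_comb (0 : 'rV['F_p]_n) v = 0.
Proof. by rewrite Fp_combE big1 // => i _; rewrite mxE rmorph0 mul0r. Qed.

Lemma Fp_combD n (e e' : 'rV['F_p]_n) (v : 'I_n -> R) :
  Fp_comb (e + e') v = Fp_comb e v + Fp_comb e' v.
Proof.
rewrite !Fp_combE -big_split; apply: eq_bigr => i _ /=.
by rewrite mxE rmorphD mulrDl.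
Qed.

Lemma Fp_combZ n c (e : 'rV['F_p]_n) (v : 'I_n -> R) :
  Fp_comb (c *: e) v = natrFp pcharR c * Fp_comb e v.
Proof.
rewrite !Fp_combE mulr_sumr; apply: eq_bigr => i _ /=.
by rewrite mxE rmorphM mulrA.
Qed.

Lemma Fp_combB n (e e' : 'rV['F_p]_n) (v : 'I_n -> R) :
  Fp_comb (e - e') v = Fp_comb e v - Fp_comb e' v.
Proof. by rewrite Fp_combD -scaleN1r Fp_combZ rmorphN1 mulN1r. Qed.

Lemma Fp_comb_delta n i (v : 'I_n -> R) :
  Fp_comb (delta_mx 0 i : 'rV['F_p]_n) v = v i.
Proof.
rewrite Fp_combE (bigD1 i) //= big1 => [|j ne_j].
  by rewrite mxE !eqxx rmorph1 mul1r addr0.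
by rewrite mxE (negPf ne_j) andbF rmorph0 mul0r.
Qed.

Lemma Fp_comb_mulmx m n (e : 'rV['F_p]_m) (M : 'M['F_p]_(m, n))
    (v : 'I_n -> R) :
  Fp_comb (e *m M) v = Fp_comb e (fun i => Fp_comb (row i M) v).
Proof.
rewrite !Fp_combE; under [RHS]eq_bigr do rewrite Fp_combE mulr_sumr.
rewrite exchange_big; apply: eq_bigr => j _ /=.
rewrite mxE rmorph_sum mulr_suml.
by apply: eq_bigr => i _; rewrite mxE rmorphM mulrA.
Qed.

Lemma Fp_comb_ker0_inj n (v : 'I_n -> R) :
  (forall e : 'rV['F_p]_n, Fp_comb e v = 0 -> e = 0) ->
  injective (fun e : 'rV['F_p]_n => Fp_comb e v).
Proof.
move=> ker0 e e' /= ee'; apply/subr0_eq/ker0.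
by rewrite Fp_combB ee' subrr.
Qed.

End PrimeFieldScalars.

Lemma natrFp_expr (R : comNzRingType) (p : nat) (pcharR : p \in [pchar R]) q c :
  [pchar R].-nat q -> natrFp pcharR c ^+ q = natrFp pcharR c.
Proof. by move=> q_pchar; rewrite expr_nat_pchar. Qed.

Lemma rmorph_natrFp (R S : nzRingType) (phi : {rmorphism R -> S}) (p : nat)
    (pcharR : p \in [pchar R]) (pcharS : p \in [pchar S]) c :
  phi (natrFp pcharR c) = natrFp pcharS c.
Proof. exact: rmorph_nat. Qed.

Lemma pFrobenius_fixed (R : comNzRingType) (p : nat) (pcharR : p \in [pchar R])
    (x : R) : GRing.integral_domain_axiom R ->
  x ^+ p = x -> exists c : 'F_p, x = natrFp pcharR c.
Proof.
move=> R_domain xp; have : \prod_(c : 'F_p) (x - natrFp pcharR c) = 0.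
  have := congr1 (fun g => (map_poly (natrFp pcharR) g).[x])
    (finField_genPoly 'F_p).
  rewrite /= card_Fp ?(pcharf_prime pcharR) // rmorphB rmorphXn /= map_polyX.
  rewrite !hornerE xp subrr => ->; rewrite rmorph_prod horner_prod.
  by apply: eq_bigr => c _; rewrite rmorphB /= map_polyX map_polyC !hornerE.
elim: (index_enum _) => [|c s IHs]; rewrite ?big_nil ?big_cons.
  by move/eqP; rewrite oner_eq0.
by move/R_domain=> /orP[|/eqP/IHs//]; rewrite subr_eq0 => /eqP ->; exists c.
Qed.

Lemma morph_Fp_comb (V W : zmodType) (phi : V -> W) (p n : nat)
    (eps : 'rV['F_p]_n) (v : 'I_n -> V) : {morph phi : x y / x + y} ->
  phi (Fp_comb eps v) = Fp_comb eps (fun i => phi (v i)).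
Proof.
move=> phiD; have phi0 : phi 0 = 0.
  by apply: (addrI (phi 0)); rewrite -phiD !addr0.
rewrite /Fp_comb (big_morph phi phiD phi0); apply: eq_bigr => i _.
by elim: (nat_of_ord _) => [|m IHm]; rewrite ?mulr0n // !mulrS phiD IHm.
Qed.

Lemma Fp_comb_expr (R : comNzRingType) (p n : nat) (eps : 'rV['F_p]_n)
    (v : 'I_n -> R) q : [pchar R].-nat q ->
  Fp_comb eps v ^+ q = Fp_comb eps (fun i => v i ^+ q).
Proof.
by move=> q_pchar; apply: (morph_Fp_comb (phi := fun x => x ^+ q)) => x y;
  apply: exprDn_pchar.
Qed.

Lemma Fp_spanP (V : zmodType) (p n : nat) (v : 'I_n -> V) x :
  reflect (exists eps : 'rV['F_p]_n, x = Fp_comb eps v) (x \in Fp_span p v).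
Proof.
rewrite mem_undup; apply: (iffP imageP) => [[e _ ->]|[e ->]]; by exists e.
Qed.

Lemma size_Fp_span (V : zmodType) (p n : nat) (v : 'I_n -> V) :
  prime p -> injective (fun eps : 'rV['F_p]_n => Fp_comb eps v) ->
  size (Fp_span p v) = (p ^ n)%N.
Proof.
move=> p_pr v_inj; rewrite /Fp_span undup_id; last first.
  by rewrite (map_inj_uniq v_inj) enum_uniq.
by rewrite size_map -cardE card_mx card_Fp // mul1n.
Qed.

Section PrimeFieldSpan.
Variables (R : nzRingType) (p n : nat) (pcharR : p \in [pchar R]).
Implicit Types v : 'I_n -> R.

Lemma Fp_span0 v : 0 \in Fp_span p v.
Proof. by apply/Fp_spanP; exists 0; rewrite (Fp_comb0 pcharR). Qed.

Lemma Fp_spanD v : {in Fp_span p v &, forall x y, x + y \in Fp_span p v}.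
Proof.
move=> _ _ /Fp_spanP[d ->] /Fp_spanP[e ->]; apply/Fp_spanP.
by exists (d + e); rewrite (Fp_combD pcharR).
Qed.

Lemma mem_Fp_span v i : v i \in Fp_span p v.
Proof.
by apply/Fp_spanP; exists (delta_mx 0 i); rewrite (Fp_comb_delta pcharR).
Qed.

Lemma Fp_span_sign v :
  Fp_span p (fun i => (-1) ^+ (i : nat) * v i) =i Fp_span p v.
Proof.
pose alternate (e : 'rV['F_p]_n) := \row_i ((-1) ^+ (i : nat) * e 0 i).
have alternateK : involutive alternate.
  by move=> e; apply/rowP=> i; rewrite !mxE signrMK.
have combE e : Fp_comb e (fun i => (-1) ^+ (i : nat) * v i)
             = Fp_comb (alternate e) v.
  rewrite !(Fp_combE pcharR); apply: eq_bigr => i _.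
  by rewrite mxE rmorphM rmorph_sign mulrA; congr (_ * _); apply: commr_sign.
move=> x; apply/Fp_spanP/Fp_spanP => -[e ->]; exists (alternate e).
  exact: combE.
by rewrite combE alternateK.
Qed.

End PrimeFieldSpan.

(** * Moore determinants and their cofactors *)

Section Moore.
Variables (R : comNzRingType) (p : nat).

Definition moore_mx n (a : 'I_n -> R) : 'M[R]_n :=
  \matrix_(i, j) a j ^+ (p ^ i).

Lemma moore_scale n (s a : 'I_n -> R) : (forall j, s j ^+ p = s j) ->
  moore p (fun j => s j * a j) = (\prod_j s j) * moore p a.
Proof.
move=> s_fixed; have s_fixedX j k : s j ^+ (p ^ k) = s j.
  by elim: k => // k IHk; rewrite expnS exprM s_fixed.
have -> : moore p (fun j => s j * a j)
        = \det (moore_mx a *m diag_mx (\row_j s j)).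
  congr (\det _); apply/matrixP=> i j.
  by rewrite mul_mx_diag !mxE exprMn s_fixedX mulrC.
rewrite det_mulmx det_diag mulrC; congr (_ * _).
by apply: eq_bigr => j _; rewrite mxE.
Qed.

Hypothesis pcharR : p \in [pchar R].

Lemma moore_expr n (a : 'I_n -> R) q : [pchar R].-nat q ->
  moore p (fun j => a j ^+ q) = moore p a ^+ q.
Proof.
move=> q_pchar; rewrite expr_det_pchar //; congr (\det _).
by apply/matrixP=> i j; rewrite !mxE -!exprM mulnC.
Qed.

Section Cofactors.
Variables (n : nat) (f : 'I_n.+1 -> R).
Local Notation Delta := (moore p f).

Definition moore_cofactor (j : 'I_n.+1) : R := (-1) ^+ j * hat_moore p f j.

Lemma moore_cofactor_last j :
  cofactor (moore_mx f) ord_max j = (-1) ^+ n * moore_cofactor j.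
Proof.
rewrite /cofactor exprD -mulrA; congr (_ * (_ * \det _)).
by apply/matrixP=> i k; rewrite !mxE lift_max.
Qed.

Lemma moore_cofactor_first j :
  cofactor (moore_mx f) ord0 j = moore_cofactor j ^+ p.
Proof.
rewrite /moore_cofactor exprMn expr_sign_pchar ?pchar_nat //; congr (_ * _).
rewrite expr_det_pchar ?pchar_nat //; congr (\det _).
by apply/matrixP=> i k; rewrite !mxE /= -exprM -expnSr.
Qed.

Definition moore_pairing (k i : nat) : R :=
  \sum_j moore_cofactor j ^+ (p ^ k) * f j ^+ (p ^ i).

Lemma moore_pairing_expr k i d :
  moore_pairing k i ^+ (p ^ d) = moore_pairing (k + d) (i + d).
Proof.
rewrite expr_sum_pchar ?pchar_natX //; apply: eq_bigr => j _.
by rewrite exprMn -!exprM -!expnD.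
Qed.

Let moore_pairing0 i : (i <= n)%N ->
  moore_pairing 0 i = ((-1) ^+ n * Delta) *+ (i == n).
Proof.
rewrite -ltnS => lt_in; pose i' := Ordinal lt_in.
have /matrixP/(_ i' ord_max) := mul_mx_adj (moore_mx f).
rewrite !mxE -mulrnAr => <-; rewrite mulr_sumr; apply: eq_bigr => j _.
by rewrite !mxE moore_cofactor_last expr1 mulrCA signrMK mulrC.
Qed.

Lemma moore_pairing_eq0 k i : (k <= i < k + n)%N -> moore_pairing k i = 0.
Proof.
case/andP=> le_ki lt_ik; rewrite -(subnK le_ki) -(moore_pairing_expr 0).
rewrite moore_pairing0; last lia.
have /negPf -> : (i - k)%N != n by lia.
by rewrite mulr0n expr0n_pchar ?pchar_natX.
Qed.

Lemma moore_pairing_addn k :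
  moore_pairing k (k + n) = ((-1) ^+ n * Delta) ^+ (p ^ k).
Proof. by rewrite addnC -(moore_pairing_expr 0) moore_pairing0 ?eqxx. Qed.

Lemma moore_pairing_pred k : moore_pairing k.+1 k = Delta ^+ (p ^ k).
Proof.
rewrite -[k.+1]add1n -(moore_pairing_expr 1 0); congr (_ ^+ _).
rewrite [RHS](expand_det_row (moore_mx f) ord0); apply: eq_bigr => j _.
by rewrite moore_cofactor_first mxE mulrC.
Qed.

(* The matrix of the pairings of [moore_cofactor ^+ p ^ k.+1] with
   [f ^+ p ^ i] is triangular. *)
Lemma moore_moore_cofactor :
  moore p moore_cofactor ^+ p * Delta = \prod_(k < n.+1) Delta ^+ (p ^ k).
Proof.
rewrite -moore_expr ?pchar_nat // -[Delta in LHS](det_tr (moore_mx f)).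
set cof_mx := moore_mx (fun j => moore_cofactor j ^+ p).
have entryE k i : (cof_mx *m (moore_mx f)^T) k i = moore_pairing k.+1 i.
  by rewrite mxE; apply: eq_bigr => j _; rewrite !mxE -exprM expnS.
rewrite -[moore _ _]/(\det cof_mx) -det_mulmx det_trig; last first.
  apply/is_trig_mxP=> k i lt_ki; rewrite entryE moore_pairing_eq0 //.
  by have := ltn_ord i; lia.
by apply: eq_bigr => k _; rewrite entryE moore_pairing_pred.
Qed.

End Cofactors.
End Moore.

Section MooreField.
Variables (K : fieldType) (p : nat) (pcharK : p \in [pchar K]).

Lemma moore_neq0_inj n (a : 'I_n -> K) :
  moore p a != 0 -> injective (fun eps : 'rV['F_p]_n => Fp_comb eps a).
Proof.
move=> a_neq0; apply: (Fp_comb_ker0_inj pcharK) => e ea0.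
pose c := \col_i natrFp pcharK (e 0 i).
have Mc : moore_mx p a *m c = 0.
  apply/matrixP=> i j; rewrite !mxE -[RHS](expr0n_pchar (pchar_natX pcharK i)).
  rewrite -[in RHS]ea0 Fp_comb_expr ?pchar_natX // (Fp_combE pcharK).
  by apply: eq_bigr => k _; rewrite !mxE mulrC.
have uM : moore_mx p a \in unitmx by rewrite unitmxE unitfE.
have c0 : c = 0 by rewrite -[c](mulKmx uM) Mc mulmx0.
apply/rowP=> i; rewrite mxE; apply: (fmorph_inj (natrFp pcharK)).
by move/matrixP/(_ i 0): c0; rewrite !mxE rmorph0.
Qed.

Lemma moore_neq0_nonzero n (a : 'I_n -> K) i : moore p a != 0 -> a i != 0.
Proof.
move=> /moore_neq0_inj a_inj; apply/eqP=> ai0.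
have := a_inj (delta_mx 0 i) 0; rewrite (Fp_comb_delta pcharK) ai0.
rewrite (Fp_comb0 pcharK) => /(_ erefl)/rowP/(_ i)/eqP.
by rewrite !mxE !eqxx oner_eq0.
Qed.

Variables (n : nat) (f : 'I_n.+1 -> K).
Hypothesis f_moore : moore p f != 0.

Lemma moore_cofactor_moore_neq0 : moore p (moore_cofactor p f) != 0.
Proof.
have : \prod_(k < n.+1) moore p f ^+ (p ^ k) != 0.
  by apply/prodf_neq0 => k _; rewrite expf_neq0.
rewrite -moore_moore_cofactor //; apply: contraNneq => ->.
by rewrite expr0n_pchar ?pchar_nat ?mul0r.
Qed.

Lemma hat_moore_moore_neq0 : moore p (hat_moore p f) != 0.
Proof.
have := moore_cofactor_moore_neq0; rewrite moore_scale => [|j].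
  by rewrite mulf_eq0 negb_or => /andP[].
by rewrite expr_sign_pchar ?pchar_nat.
Qed.

Lemma Fp_span_moore_cofactor :
  Fp_span p (moore_cofactor p f) =i Fp_span p (hat_moore p f).
Proof. exact: Fp_span_sign. Qed.

End MooreField.

(** * Linearized polynomials *)

Section Linearized.
Variables (R : comNzRingType) (p n : nat) (c : nat -> R).

Definition linearized : {poly R} := \sum_(m < n.+1) c m *: 'X^(p ^ m).

Lemma horner_linearized x :
  linearized.[x] = \sum_(m < n.+1) c m * x ^+ (p ^ m).
Proof.
by rewrite horner_sum; apply: eq_bigr => m _; rewrite hornerZ hornerXn.
Qed.

Lemma horner_linearizedD :
  p \in [pchar R] -> {morph horner linearized : x y / x + y}.
Proof.
move=> pcharR x y; rewrite !horner_linearized -big_split.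
by apply: eq_bigr => m _; rewrite /= exprDn_pchar ?pchar_natX // mulrDr.
Qed.

Hypothesis p_gt1 : (1 < p)%N.

Lemma coef_linearized m : (m <= n)%N -> linearized`_(p ^ m) = c m.
Proof.
rewrite -ltnS => lt_m; rewrite coef_sum (bigD1 (Ordinal lt_m)) //= big1.
  by rewrite coefZ coefXn eqxx mulr1 addr0.
move=> i; rewrite -val_eqE /= => ne_i; rewrite coefZ coefXn.
by rewrite eqn_exp2l // eq_sym (negPf ne_i) mulr0.
Qed.

Lemma size_linearized : (size linearized <= (p ^ n).+1)%N.
Proof.
apply: (leq_trans (size_sum _ _ _)); apply/bigmax_leqP => m _.
apply: (leq_trans (size_scale_leq _ _)); rewrite size_polyXn ltnS.
by rewrite leq_exp2l // -ltnS.
Qed.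

Lemma lead_coef_linearized : c n != 0 -> lead_coef linearized = c n.
Proof.
move=> cn_neq0; rewrite lead_coefE; suff -> : size linearized = (p ^ n).+1.
  exact: coef_linearized.
apply/eqP; rewrite eqn_leq size_linearized /= ltnNge.
apply: contra cn_neq0 => /leq_sizeP/(_ _ (leqnn _)).
by rewrite coef_linearized // => ->.
Qed.

End Linearized.

Lemma linearized_prod_XsubC (F : fieldType) (p n : nat) (c : nat -> F)
    (rs : seq F) :
    (1 < p)%N -> linearized p n c != 0 -> all (root (linearized p n c)) rs ->
    uniq rs -> size rs = (p ^ n)%N ->
  linearized p n c
    = lead_coef (linearized p n c) *: \prod_(z <- rs) ('X - z%:P).
Proof.
move=> p_gt1 nz rs_roots rs_uniq size_rs; apply: all_roots_prod_XsubC => //.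
  by apply/eqP; rewrite eqn_leq max_poly_roots // size_rs size_linearized.
by rewrite uniq_rootsE.
Qed.

Definition moore_poly (R : comNzRingType) (p n : nat) (a : 'I_n -> R) :
    {poly R} :=
  moore p (fun j : 'I_n.+1 =>
             if unlift ord_max j is Some i then (a i)%:P else 'X).

Section MoorePolynomial.
Variables (R : comNzRingType) (p n : nat) (a : 'I_n -> R).

Lemma moore_poly_linearized :
  exists2 c, c n = moore p a & moore_poly p a = linearized p n c.
Proof.
pose minor (m : 'I_n.+1) :=
  \det (row' m (\matrix_(i < n.+1, j < n) a j ^+ (p ^ i))).
pose l (m : 'I_n.+1) := (-1) ^+ (m + n) * minor m.
exists (fun m => l (inord m)).
  have -> : inord n = ord_max :> 'I_n.+1 by apply/val_inj; rewrite /= inordK.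
  rewrite /l /minor /= exprD -expr2 sqrr_sign mul1r; congr (\det _).
  by apply/matrixP=> i j; rewrite !mxE lift_max.
rewrite /moore_poly /moore (expand_det_col _ ord_max); apply: eq_bigr => m _.
rewrite !mxE unlift_none mulrC -mul_polyC inord_val; congr (_ * _).
rewrite /cofactor /l /minor rmorphM rmorph_sign /=; congr (_ * _).
rewrite -det_map_mx; congr (\det _); apply/matrixP=> i j.
by rewrite !mxE liftK rmorphXn.
Qed.

Lemma root_moore_poly j : root (moore_poly p a) (a j).
Proof.
rewrite /root -[_.[_]]/(horner_eval (a j) _) -det_map_mx -det_tr; apply/eqP.
apply: (@determinant_alternate _ _ _ (lift ord_max j) ord_max).
  by rewrite eq_sym neq_lift.
move=> m; rewrite !mxE liftK unlift_none.
by rewrite !rmorphXn /= /horner_eval hornerC hornerX.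
Qed.

End MoorePolynomial.

Lemma eq_span_poly (K : fieldType) p m n (a : 'I_m -> K) (b : 'I_n -> K) :
  Fp_span p a =i Fp_span p b -> span_poly p a = span_poly p b.
Proof. by move=> ab; apply/perm_big/uniq_perm; rewrite ?undup_uniq. Qed.

Section SpanPolynomial.
Variables (K : fieldType) (p : nat) (pcharK : p \in [pchar K]).
Variables (n : nat) (a : 'I_n -> K).
Hypothesis a_moore : moore p a != 0.
Let p_pr := pcharf_prime pcharK.
Let p_gt1 := prime_gt1 p_pr.

Lemma size_Fp_span_moore : size (Fp_span p a) = (p ^ n)%N.
Proof. exact/size_Fp_span/moore_neq0_inj. Qed.

Lemma root_span_poly x : root (span_poly p a) x = (x \in Fp_span p a).
Proof. exact: root_prod_XsubC. Qed.

Lemma monic_span_poly : span_poly p a \is monic.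
Proof. exact: monic_prod_XsubC. Qed.

Lemma size_span_poly : size (span_poly p a) = (p ^ n).+1.
Proof. by rewrite size_prod_XsubC size_Fp_span_moore. Qed.

Lemma moore_poly_span_poly : moore_poly p a = moore p a *: span_poly p a.
Proof.
have [c cn aE] := moore_poly_linearized p a.
have lead_c : lead_coef (linearized p n c) = moore p a.
  by rewrite lead_coef_linearized ?cn.
rewrite aE -lead_c; apply: linearized_prod_XsubC => //; last 2 first.
- exact: undup_uniq.
- exact: size_Fp_span_moore.
- by rewrite -lead_coef_eq0 lead_c.
apply/allP => x /Fp_spanP[e ->]; apply/rootP.
rewrite (morph_Fp_comb _ _ (horner_linearizedD n c pcharK)).
rewrite /Fp_comb big1 // => i _; have /rootP := root_moore_poly p a i.
by rewrite aE => ->; rewrite mul0rn.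
Qed.

Lemma span_poly_linearized : span_poly p a = linearized p n (span_coef p a).
Proof.
have [c _ aE] := moore_poly_linearized p a.
have spanE : span_poly p a = linearized p n (fun m => (moore p a)^-1 * c m).
  rewrite -[LHS](scalerK a_moore) -moore_poly_span_poly aE scaler_sumr.
  by apply: eq_bigr => m _; rewrite scalerA.
rewrite [LHS]spanE; apply: eq_bigr => m _.
by rewrite /span_coef spanE coef_linearized // -ltnS.
Qed.

Lemma span_coef_last : span_coef p a n = 1.
Proof.
by have /monicP := monic_span_poly; rewrite lead_coefE size_span_poly.
Qed.

Lemma sum_span_coef x : x \in Fp_span p a ->
  \sum_(m < n.+1) span_coef p a m * x ^+ (p ^ m) = 0.
Proof.
by rewrite -horner_linearized -span_poly_linearized -root_span_poly => /rootP.
Qed.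

End SpanPolynomial.

(** * The dot product on row vectors *)

Section DotProduct.
Variables (R : comNzRingType) (n : nat).
Implicit Types a b e : 'rV[R]_n.

Definition dot_row a e : R := (a *m e^T) 0 0.

Lemma dot_rowE a e : dot_row a e = \sum_i a 0 i * e 0 i.
Proof. by rewrite /dot_row mxE; apply: eq_bigr => i _; rewrite mxE. Qed.

Lemma dot_rowDl a b e : dot_row (a + b) e = dot_row a e + dot_row b e.
Proof. by rewrite /dot_row mulmxDl mxE. Qed.

Lemma dot_rowZl c a e : dot_row (c *: a) e = c * dot_row a e.
Proof. by rewrite /dot_row -scalemxAl mxE. Qed.

Lemma dot_row_delta i e : dot_row (delta_mx 0 i) e = e 0 i.
Proof. by rewrite /dot_row -rowE !mxE. Qed.

End DotProduct.

Section DotProductField.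
Variables (F : fieldType) (n : nat).
Implicit Types a e : 'rV[F]_n.

Lemma dot_row_surj e c : e != 0 -> exists a, dot_row a e = c.
Proof.
case/rV0Pn=> i ei; exists ((c / e 0 i) *: delta_mx 0 i).
by rewrite dot_rowZl dot_row_delta divfK.
Qed.

Lemma dot_row_proportional e e' : e != 0 ->
  (forall a, dot_row a e = 0 -> dot_row a e' = 0) -> exists c, e' = c *: e.
Proof.
case/rV0Pn=> k ek ker; exists (e' 0 k / e 0 k); apply/rowP=> j; rewrite mxE.
have := ker (delta_mx 0 j + (- (e 0 j / e 0 k)) *: delta_mx 0 k).
rewrite !dot_rowDl !dot_rowZl !dot_row_delta mulNr divfK // subrr.
move=> /(_ erefl)/eqP; rewrite addr_eq0 mulNr opprK => /eqP ->.
by rewrite mulrAC [e 0 j * _]mulrC mulrAC.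
Qed.

End DotProductField.

Lemma Fp_additive_dot_row (p n : nat) (c : 'rV['F_p]_n -> 'F_p) :
  {morph c : a b / a + b} -> exists e, forall a, c a = dot_row a e.
Proof.
move=> cD; exists (\row_i c (delta_mx 0 i)) => a.
have aE : a = Fp_comb a (fun i => delta_mx 0 i : 'rV['F_p]_n).
  rewrite {1}[a]row_sum_delta; apply: eq_bigr => i _.
  by rewrite -{1}[a 0 i]natr_Zp scaler_nat.
rewrite {1}aE (morph_Fp_comb _ _ cD) dot_rowE; apply: eq_bigr => i _.
by rewrite mxE -[in RHS](natr_Zp (a 0 i)) mulr_natl.
Qed.

Lemma Fp_comb_translate (R : nzRingType) (p n : nat) (pcharR : p \in [pchar R])
    (phi : R -> R) (y : 'I_n -> R) (a e : 'rV['F_p]_n) :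
    {morph phi : u v / u + v} ->
    (forall j, phi (y j) = y j + natrFp pcharR (a 0 j)) ->
  phi (Fp_comb e y) = Fp_comb e y + natrFp pcharR (dot_row a e).
Proof.
move=> phiD phi_y; rewrite (morph_Fp_comb _ _ phiD) !(Fp_combE pcharR).
rewrite dot_rowE rmorph_sum -big_split; apply: eq_bigr => j _ /=.
by rewrite phi_y mulrDr -rmorphM mulrC.
Qed.

(** * The Elkies pairing and the reversed polynomial *)

Section ElkiesPower.
Variables (R : comNzRingType) (p : nat) (c : nat -> R).

(* The [p ^ n]-th power of the Elkies pairing, which needs no roots. *)
Definition elkies_power n (x u : R) : R :=
  \sum_(1 <= m < n.+1) \sum_(j < m)
    ((c m * u) ^+ (p ^ (n - m)) * x ^+ (p ^ n)) ^+ (p ^ j).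

Definition elkies_coef n (q : nat) (x : R) : R :=
  \sum_(m < n.+2 | (n < m + q)%N) c m ^+ (p ^ q) * x ^+ (p ^ (m + q)).

Lemma elkies_power_expr n x t :
  elkies_power n.+1 x (t ^+ p) =
  \sum_(q < n.+1) t ^+ (p ^ q.+1) * elkies_coef n q x.
Proof.
pose term q m := t ^+ (p ^ q.+1) * (c m ^+ (p ^ q) * x ^+ (p ^ (m + q))).
have -> : \sum_(q < n.+1) t ^+ (p ^ q.+1) * elkies_coef n q x
        = \sum_(0 <= m < n.+2) \sum_(0 <= q < n.+1 | (n < m + q)%N) term q m.
  rewrite big_mkord; under [RHS]eq_bigr do rewrite big_mkord.
  rewrite (exchange_big_dep xpredT) //.
  by apply: eq_bigr => q _; rewrite mulr_sumr.
rewrite [RHS]big_ltn // [X in _ = X + _]big_nat_cond.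
rewrite [X in _ = X + _]big_pred0 ?add0r => [|q]; last by rewrite add0n; lia.
apply: eq_big_nat => m /andP[m_gt0 le_m].
rewrite (eq_bigl (fun q => (n.+1 - m <= q)%N)); last by move=> q /=; lia.
rewrite -(@big_nat_widenl _ _ _ _ _ _ xpredT) // -{2}[(n.+1 - m)%N]add0n.
rewrite big_addn subKn // big_mkord; apply: eq_bigr => j _.
rewrite /term !exprMn -!exprM -!expnD -expnS.
have -> : (m + (j + (n.+1 - m)) = n.+1 + j)%N by lia.
rewrite mulrA [c m ^+ _ * _]mulrC addnC; congr (t ^+ (p ^ _) * _ * _); lia.
Qed.

Hypothesis pcharR : p \in [pchar R].

Lemma elkies_powerDl n u : {morph (elkies_power n)^~ u : x y / x + y}.
Proof.
move=> x y; rewrite -big_split; apply: eq_bigr => m _ /=.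
rewrite -big_split; apply: eq_bigr => j _ /=.
by rewrite exprDn_pchar ?pchar_natX // mulrDr exprDn_pchar ?pchar_natX.
Qed.

Lemma elkies_powerDr n x : {morph elkies_power n x : u v / u + v}.
Proof.
move=> u v; rewrite -big_split; apply: eq_bigr => m _ /=.
rewrite -big_split; apply: eq_bigr => j _ /=; rewrite mulrDr.
by rewrite exprDn_pchar ?pchar_natX // mulrDl exprDn_pchar ?pchar_natX.
Qed.

Lemma elkies_power_frob n x u :
  elkies_power n x u ^+ p - elkies_power n x u =
  u ^+ (p ^ n) * (linearized p n c).[x] ^+ (p ^ n)
  - x ^+ (p ^ n) * (linearized p n (fun m => c (n - m) ^+ (p ^ m))).[u].
Proof.
pose term m j := ((c m * u) ^+ (p ^ (n - m)) * x ^+ (p ^ n)) ^+ (p ^ j).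
have -> : elkies_power n x u ^+ p
        = \sum_(1 <= m < n.+1) \sum_(j < m) term m j.+1.
  rewrite expr_sum_pchar ?pchar_nat //; apply: eq_bigr => m _.
  rewrite expr_sum_pchar ?pchar_nat //; apply: eq_bigr => j _.
  by rewrite /term -exprM -expnSr.
rewrite -sumrB; transitivity (\sum_(0 <= m < n.+1) (term m m - term m 0)).
  rewrite [RHS]big_ltn // subrr add0r; apply: eq_bigr => m _.
  by rewrite -sumrB -(telescope_sumr (term m) (leq0n m)) big_mkord.
rewrite big_mkord sumrB !horner_linearized; congr (_ - _).
  rewrite expr_sum_pchar ?pchar_natX // mulr_sumr; apply: eq_bigr => m _.
  rewrite /term !exprMn -!exprM -!expnD subnK -1?ltnS ?ltn_ord //.
  by rewrite [(n + m)%N]addnC mulrAC mulrC.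
rewrite mulr_sumr (reindex_inj rev_ord_inj); apply: eq_bigr => m _ /=.
by rewrite /term expn0 expr1 exprMn mulrC subSS subKn // -ltnS.
Qed.

End ElkiesPower.

Section ElkiesValue.
Variables (K : fieldType) (p : nat) (pcharK : p \in [pchar K]).
Variables (n : nat) (f : 'I_n.+1 -> K).
Hypothesis f_moore : moore p f != 0.
Let p_pr := pcharf_prime pcharK.
Local Notation Delta := (moore p f).
Local Notation c := (span_coef p f).

Definition moore_dual (j : 'I_n.+1) : K := moore_cofactor p f j / Delta.

Let elkies_coef_sum q k :
  \sum_j elkies_coef p c n q (f j) * moore_cofactor p f j ^+ (p ^ k) =
  \sum_(m < n.+2 | (n < m + q)%N) c m ^+ (p ^ q) * moore_pairing p f k (m + q).
Proof.
under eq_bigr do rewrite mulr_suml.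
rewrite exchange_big; apply: eq_bigr => m _ /=; rewrite mulr_sumr.
by apply: eq_bigr => j _; rewrite -mulrA [f j ^+ _ * _]mulrC.
Qed.

Let span_coef_pairing q k :
  \sum_(m < n.+2) c m ^+ (p ^ q) * moore_pairing p f k (m + q) = 0.
Proof.
under eq_bigr do rewrite mulr_sumr.
rewrite exchange_big big1 // => j _ /=.
transitivity (moore_cofactor p f j ^+ (p ^ k)
                * (\sum_(m < n.+2) c m * f j ^+ (p ^ m)) ^+ (p ^ q)).
  rewrite expr_sum_pchar ?pchar_natX // mulr_sumr; apply: eq_bigr => m _.
  by rewrite [(c m * _) ^+ _]exprMn -[(f j ^+ _) ^+ _]exprM -expnD mulrCA.
by rewrite sum_span_coef ?mem_Fp_span // expr0n_pchar ?pchar_natX ?mulr0.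
Qed.

Lemma elkies_coef_cofactor q q' : (q <= n)%N -> (q' <= n)%N ->
  \sum_j elkies_coef p c n q (f j) * moore_cofactor p f j ^+ (p ^ q'.+1) =
  ((-1) ^+ n * Delta) ^+ (p ^ q.+1) *+ (q == q').
Proof.
move=> le_qn le_q'n; rewrite elkies_coef_sum.
have [lt_qq'|lt_q'q|<-{q' le_q'n}] := ltngtP q q'.
- rewrite big1 // => m lt_m; rewrite moore_pairing_eq0 ?mulr0 //.
  by have := ltn_ord m; lia.
- rewrite big_rmcond ?span_coef_pairing // => m le_m.
  by rewrite moore_pairing_eq0 ?mulr0 //; lia.
rewrite (bigD1 ord_max) /=; last by rewrite leq_addr.
rewrite span_coef_last // expr1n mul1r addSnnS addnC moore_pairing_addn //.
rewrite big1 ?addr0 ?mulr1n // => m /andP[lt_m ne_m].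
rewrite moore_pairing_eq0 ?mulr0 //.
by have := ltn_ord m; move: ne_m; rewrite -val_eqE /=; lia.
Qed.

(* A one-sided inverse of a square matrix is two-sided; this turns the
   orthogonality over [j] into an orthogonality over [q]. *)
Lemma elkies_coef_dual i k :
  \sum_(q < n.+1) moore_dual k ^+ (p ^ q.+1) * elkies_coef p c n q (f i) =
  (-1) ^+ n *+ (k == i).
Proof.
pose coef_mx := \matrix_(q < n.+1, j < n.+1) elkies_coef p c n q (f j).
pose dual_mx := \matrix_(j < n.+1, q < n.+1)
  ((-1) ^+ n * moore_dual j ^+ (p ^ q.+1)).
have coef_dual : coef_mx *m dual_mx = 1%:M.
  apply/matrixP=> q q'; rewrite !mxE.
  transitivity ((-1) ^+ n / Delta ^+ (p ^ q'.+1) * \sum_j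
      elkies_coef p c n q (f j) * moore_cofactor p f j ^+ (p ^ q'.+1)).
    rewrite mulr_sumr; apply: eq_bigr => j _.
    rewrite !mxE exprMn exprVn mulrCA -!mulrA; congr (_ * _).
    by rewrite mulrA mulrC.
  rewrite elkies_coef_cofactor -1?ltnS ?ltn_ord //.
  rewrite -[(q : nat) == q']/(q == q').
  have [->|ne_q] := eqVneq q q'; last by rewrite mulr0.
  rewrite !mulr1n exprMn expr_sign_pchar ?pchar_natX // mulrACA -expr2.
  by rewrite sqrr_sign mulVf ?mulr1 // expf_neq0.
have /matrixP/(_ k i) := mulmx1C coef_dual.
rewrite !mxE => /(congr1 ( *%R ((-1) ^+ n))); rewrite -mulr_natr => <-.
rewrite mulr_sumr; apply: eq_bigr => q _.
by rewrite !mxE !mulrA -expr2 sqrr_sign mul1r.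
Qed.

Lemma elkies_powerE (eps a : 'rV['F_p]_n.+1) :
  elkies_power p c n.+1 (Fp_comb eps f) (Fp_comb a moore_dual ^+ p) =
  natrFp pcharK ((-1) ^+ n * dot_row a eps).
Proof.
rewrite Fp_comb_expr ?pchar_nat //.
rewrite (morph_Fp_comb _ _ (elkies_powerDl c pcharK n.+1 _)).
rewrite dot_rowE rmorphM rmorph_sign rmorph_sum mulr_sumr (Fp_combE pcharK).
apply: eq_bigr => i _.
rewrite (morph_Fp_comb _ _ (elkies_powerDr c pcharK n.+1 _)) (Fp_combE pcharK).
rewrite (bigD1 i) //= elkies_power_expr elkies_coef_dual eqxx mulr1n.
rewrite big1 ?addr0 => [|k ne_k].
  by rewrite rmorphM mulrCA [RHS]mulrCA [_ * (-1) ^+ n]mulrC.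
by rewrite elkies_power_expr elkies_coef_dual (negPf ne_k) mulr0.
Qed.

Lemma Fp_comb_moore_dual (a : 'rV['F_p]_n.+1) :
  Fp_comb a (moore_cofactor p f) / Delta = Fp_comb a moore_dual.
Proof.
by apply: (morph_Fp_comb (phi := fun x => x / Delta)) => x y; rewrite mulrDl.
Qed.

Lemma spaceUP x : reflect
  (exists a : 'rV['F_p]_n.+1, x = Fp_comb a moore_dual ^+ p) (x \in spaceU p f).
Proof.
apply: (iffP mapP) => [[z zZ ->]|[a ->]].
  move: zZ; rewrite -Fp_span_moore_cofactor // => /Fp_spanP[a ->].
  by exists a; rewrite Fp_comb_moore_dual.
exists (Fp_comb a (moore_cofactor p f)); last by rewrite Fp_comb_moore_dual.
by rewrite -Fp_span_moore_cofactor //; apply/Fp_spanP; exists a.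
Qed.

Lemma rev_span_poly_linearized :
  rev_span_poly p f = linearized p n.+1 (fun m => c (n.+1 - m) ^+ (p ^ m)).
Proof. by []. Qed.

Lemma rev_span_poly_neq0 : rev_span_poly p f != 0.
Proof.
apply: contraNneq (oner_neq0 K) => rev0.
have := coef_linearized (fun m => c (n.+1 - m) ^+ (p ^ m))
  (prime_gt1 p_pr) (leq0n n.+1).
rewrite -rev_span_poly_linearized rev0 coef0 subn0 expr1.
by rewrite span_coef_last // => <-.
Qed.

(* The pairing of [f ord0] with [u] is fixed by Frobenius and [span_poly p f]
   kills [f ord0], so in [elkies_power_frob] only the reversed polynomial at
   [u] is left. *)
Lemma spaceU_root u : u \in spaceU p f -> root (rev_span_poly p f) u.
Proof.
case/spaceUP=> a ->{u}; set u := _ ^+ p.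
have := elkies_power_frob c pcharK n.+1 (f ord0) u.
rewrite -{1 2}(Fp_comb_delta pcharK ord0 f) elkies_powerE.
rewrite natrFp_expr ?pchar_nat // subrr -span_poly_linearized //.
have /rootP -> : root (span_poly p f) (f ord0).
  by rewrite root_span_poly // mem_Fp_span.
rewrite expr0n_pchar ?pchar_natX // mulr0 sub0r => /esym/eqP.
have /negPf f0_neq0 := moore_neq0_nonzero pcharK ord0 f_moore.
by rewrite oppr_eq0 mulf_eq0 expf_eq0 f0_neq0 andbF.
Qed.

Lemma rev_span_poly_prod_XsubC : rev_span_poly p f =
  lead_coef (rev_span_poly p f) *: \prod_(u <- spaceU p f) ('X - u%:P).
Proof.
rewrite rev_span_poly_linearized; apply: linearized_prod_XsubC.
- exact: prime_gt1.
- by rewrite -rev_span_poly_linearized rev_span_poly_neq0.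
- by apply/allP => x /spaceU_root.
- rewrite map_inj_uniq ?undup_uniq // => x y.
  by move/(expr_inj_pchar (pchar_nat pcharK)); apply/mulIf; rewrite invr_eq0.
by rewrite size_map size_Fp_span_moore ?hat_moore_moore_neq0.
Qed.

Lemma root_rev_span_poly x : root (rev_span_poly p f) x = (x \in spaceU p f).
Proof.
rewrite rev_span_poly_prod_XsubC rootZ ?root_prod_XsubC //.
by rewrite lead_coef_eq0 rev_span_poly_neq0.
Qed.

Lemma root_map_rev_span_poly (L : fieldType) (iota : {rmorphism K -> L}) y :
  root (map_poly iota (rev_span_poly p f)) y ->
  exists2 u, u \in spaceU p f & y = iota u.
Proof.
rewrite rev_span_poly_prod_XsubC map_polyZ rootZ; last first.
  by rewrite fmorph_eq0 lead_coef_eq0 rev_span_poly_neq0.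
rewrite map_prod_XsubC -(big_map iota xpredT (fun z => 'X - z%:P)).
by rewrite root_prod_XsubC => /mapP[u]; exists u.
Qed.

Section AlgebraicClosure.
Variables (L : closedFieldType) (iota : {rmorphism K -> L}).
Let pcharL : p \in [pchar L]. Proof. by rewrite (fmorph_pchar iota). Qed.

Lemma closed_rootK d (x : L) : (0 < d)%N -> closed_root d x ^+ d = x.
Proof.
by move=> d_gt0; apply/eqP/(implyP (xchooseP (closed_root_subproof d x))).
Qed.

Lemma elkies_expr x u :
  elkies p f iota x u ^+ (p ^ n.+1) = iota (elkies_power p c n.+1 x u).
Proof.
rewrite expr_sum_pchar ?pchar_natX // rmorph_sum.
apply: eq_big_nat => m /andP[m_gt0 le_m].
rewrite expr_sum_pchar ?pchar_natX // rmorph_sum; apply: eq_bigr => j _.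
rewrite -exprM mulnC exprM exprMn [RHS]rmorphXn; congr (_ ^+ _).
rewrite [RHS]rmorphM !rmorphXn; congr (_ * _).
have -> : (p ^ n.+1 = p ^ m * p ^ (n.+1 - m))%N by rewrite -expnD subnKC.
by rewrite exprM closed_rootK // expn_gt0 prime_gt0.
Qed.

Lemma elkiesE (eps a : 'rV['F_p]_n.+1) :
  elkies p f iota (Fp_comb eps f) (Fp_comb a moore_dual ^+ p) =
  natrFp pcharL ((-1) ^+ n * dot_row a eps).
Proof.
apply: (expr_inj_pchar (pchar_natX pcharL n.+1)).
rewrite elkies_expr elkies_powerE (rmorph_natrFp _ _ pcharL).
by rewrite natrFp_expr ?pchar_natX.
Qed.

Lemma spaceU_closed_root z : z \in Fp_span p (hat_moore p f) ->
  exists2 u, u \in spaceU p f & iota z = iota Delta * closed_root p (iota u).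
Proof.
move=> zZ; exists ((z / Delta) ^+ p); first by apply/mapP; exists z.
apply: (expr_inj_pchar (pchar_nat pcharL)).
rewrite exprMn closed_rootK ?prime_gt0 // -!rmorphXn -rmorphM -exprMn.
by rewrite mulrC divfK.
Qed.

End AlgebraicClosure.
End ElkiesValue.

(** * Algebras generated by one element *)

Section GeneratedAlgebra.
Variable K : fieldType.
Implicit Types A B : comAlgType K.

Lemma horner_algZ A (a : A) k g : horner_alg a (k *: g) = k *: horner_alg a g.
Proof. by rewrite linearZ /= mulr_algl. Qed.

Lemma horner_alg_XaddC A (a : A) k : horner_alg a ('X + k%:P) = a + k%:A.
Proof. by rewrite rmorphD /= horner_algX horner_algC. Qed.

Lemma horner_alg_comp A (a : A) g h :
  horner_alg a (h \Po g) = horner_alg (horner_alg a g) h.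
Proof.
elim/poly_ind: h => [|h k IHh]; first by rewrite comp_poly0 !rmorph0.
rewrite comp_polyD comp_polyM comp_polyX comp_polyC !rmorphD !rmorphM /=.
by rewrite IHh !horner_algX !horner_algC.
Qed.

Lemma lrmorph_horner_alg A B (phi : {lrmorphism B -> A}) x g :
  phi (horner_alg x g) = horner_alg (phi x) g.
Proof.
elim/poly_ind: g => [|g k IHg]; first by rewrite !rmorph0.
rewrite !(rmorphD, rmorphM) /= !horner_algX !horner_algC.
by rewrite IHg rmorph_alg.
Qed.

Lemma horner_alg_linearized A p n (c : nat -> K) (x : A) :
  horner_alg x (linearized p n c) = \sum_(m < n.+1) c m *: x ^+ (p ^ m).
Proof.
rewrite rmorph_sum; apply: eq_bigr => m _ /=.
by rewrite horner_algZ rmorphXn /= horner_algX.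
Qed.

Lemma lrmorphism_of A B (phi : B -> A) : linear phi -> monoid_morphism phi ->
  exists psi : {lrmorphism B -> A}, psi =1 phi.
Proof.
move=> phiL phiM.
pose lin := GRing.isSemilinear.Build K B A _ phi (GRing.semilinear_linear phiL).
pose mul := GRing.isMonoidMorphism.Build B A phi phiM.
by exists (HB.pack phi lin mul : {lrmorphism B -> A}).
Qed.

Lemma gen_alg_subalg A (a : A) : is_subalg (gen_alg a).
Proof.
split=> [|k _ _ [g ->] [h ->]|_ _ [g ->] [h ->]].
- by exists 1; rewrite rmorph1.
- by exists (k *: g + h); rewrite rmorphD /= horner_algZ.
by exists (g * h); rewrite rmorphM.
Qed.

Lemma gen_alg_self A (a : A) : gen_alg a a.
Proof. by exists 'X; rewrite horner_algX. Qed.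

Lemma gen_alg_trans A (a b c : A) : gen_alg a b -> gen_alg b c -> gen_alg a c.
Proof. by case=> g -> [h ->]; exists (h \Po g); rewrite horner_alg_comp. Qed.

Lemma gen_algD A (a : A) k b : gen_alg (a + k%:A) b <-> gen_alg a b.
Proof.
have sub (c : A) (l : K) : gen_alg c (c + l%:A).
  by exists ('X + l%:P); rewrite horner_alg_XaddC.
split; apply: gen_alg_trans => //.
by rewrite -{2}[a](addrK k%:A) -scaleNr; apply: sub.
Qed.

Lemma Fp_comb_AS_equation A p n (f : 'I_n -> K) (y : 'I_n -> A)
    (e : 'rV['F_p]_n) :
    p \in [pchar K] -> (forall j, y j ^+ p - y j = (f j)%:A) ->
  Fp_comb e y ^+ p - Fp_comb e y = (Fp_comb e f)%:A.
Proof.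
move=> pcharK y_equation; have pcharA : p \in [pchar A] by rewrite pchar_lalg.
rewrite (morph_Fp_comb _ _ (AS_operatorD pcharA)).
rewrite -[RHS]/(GRing.in_alg A _) (morph_Fp_comb _ _ (rmorphD _)).
by apply: eq_bigr => j _; rewrite y_equation.
Qed.

Section Subalgebra.
Variables (A : comAlgType K) (V : A -> Prop).
Hypothesis V_subalg : is_subalg V.

Lemma subalgZ k a : V a -> V (k *: a).
Proof.
case: V_subalg => V1 VL _ Va; rewrite -[_ *: _]addr0; apply: (VL) => //.
by rewrite -(subrr 1) -scaleN1r addrC; apply: VL.
Qed.

Lemma subalg_sum (I : Type) (r : seq I) (P : pred I) (F : I -> A) :
  (forall i, P i -> V (F i)) -> V (\sum_(i <- r | P i) F i).
Proof.
case: V_subalg => V1 VL _ VF; apply: big_ind => // [|a b Va Vb].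
  by rewrite -(scale0r 1); apply: subalgZ.
by rewrite -[a]scale1r; apply: VL.
Qed.

Lemma subalgX a m : V a -> V (a ^+ m).
Proof.
case: V_subalg => V1 _ VM Va; elim: m => // m IHm; rewrite exprS; exact: VM.
Qed.

End Subalgebra.

Definition is_minpoly A (h : {poly K}) (a : A) : Prop :=
  forall g, horner_alg a g = 0 <-> h %| g.

Lemma is_minpoly_root A h (a : A) : is_minpoly h a -> horner_alg a h = 0.
Proof. by move=> ha; apply/ha. Qed.

Lemma horner_alg_modp A (a : A) g h :
  horner_alg a h = 0 -> horner_alg a (g %% h) = horner_alg a g.
Proof.
by move=> ah; rewrite [in RHS](divp_eq g h) rmorphD rmorphM /= ah mulr0 add0r.
Qed.

Lemma irreducible_minpoly A h (a : A) :
  irreducible_poly h -> horner_alg a h = 0 -> is_minpoly h a.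
Proof.
move=> irr_h ah g; split=> [ag|/dvdpP[q ->]]; last first.
  by rewrite rmorphM /= ah mulr0.
apply: contraT; rewrite -irreducible_poly_coprime //.
case/Bezout_eq1_coprimepP=> -[u v] /= /(congr1 (horner_alg a)).
rewrite rmorphD !rmorphM rmorph1 /= ah ag !mulr0 addr0 => /eqP.
by rewrite eq_sym oner_eq0.
Qed.

Lemma minpoly_irreducible A (h : {poly K}) (a : A) :
    GRing.integral_domain_axiom A -> (1 < size h)%N -> is_minpoly h a ->
  irreducible_poly h.
Proof.
move=> A_domain h_gt1 ha; have h_neq0 : h != 0 by rewrite -size_poly_gt0 ltnW.
split=> // q q_neq1 qh; have /dvdpP[r hE] := qh.
have [r_neq0 q_neq0] : r != 0 /\ q != 0.
  by move: h_neq0; rewrite hE mulf_eq0 negb_or => /andP.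
have /orP[/eqP/ha hr|/eqP/ha hq] :
    (horner_alg a r == 0) || (horner_alg a q == 0).
- by apply: A_domain; rewrite -rmorphM -hE /= (is_minpoly_root ha).
- have := dvdp_leq r_neq0 hr; rewrite hE size_mul //.
  by move: q_neq1 q_neq0 r_neq0; rewrite -!size_poly_gt0; lia.
by rewrite /eqp qh hq.
Qed.

Lemma irreducible_minpoly_is_field A (h : {poly K}) (a : A) :
    irreducible_poly h -> is_minpoly h a -> (forall b, gen_alg a b) ->
  is_field A.
Proof.
move=> irr_h ha gen_a b; have [g ->] := gen_a b => gb.
have : ~~ (h %| g) by apply: contraNN gb => /ha ->.
rewrite -irreducible_poly_coprime //.
case/Bezout_eq1_coprimepP=> -[u v] /= /(congr1 (horner_alg a)).
rewrite rmorphD !rmorphM rmorph1 /= (is_minpoly_root ha) mulr0 add0r mulrC.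
by exists (horner_alg a v).
Qed.

Lemma is_field_domain A : is_field A -> GRing.integral_domain_axiom A.
Proof.
move=> A_field a b ab0; have [//|/A_field[c ac]] := eqVneq a 0.
by rewrite -[b]mul1r -ac mulrAC ab0 mul0r eqxx.
Qed.

Lemma gen_alg_lift A B h (x : B) (a : A) :
    (forall b, gen_alg x b) -> is_minpoly h x -> horner_alg a h = 0 ->
  exists phi : {lrmorphism B -> A}, phi x = a.
Proof.
move=> /choice[G GE] hx ah.
have aG g : horner_alg a (G (horner_alg x g)) = horner_alg a g.
  apply/subr0_eq; rewrite -rmorphB /=.
  have /hx/dvdpP[q ->] : horner_alg x (G (horner_alg x g) - g) = 0.
    by rewrite rmorphB /= -GE subrr.
  by rewrite rmorphM /= ah mulr0.
have [||phi phiE] := @lrmorphism_of A B (fun b => horner_alg a (G b)).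
- move=> k b c; have -> : k *: b + c = horner_alg x (k *: G b + G c).
    by rewrite rmorphD /= horner_algZ -!GE.
  by rewrite aG rmorphD /= horner_algZ.
- split=> [|b c]; first by rewrite -(rmorph1 (horner_alg x)) aG rmorph1.
  have -> : b * c = horner_alg x (G b * G c) by rewrite rmorphM /= -!GE.
  by rewrite aG rmorphM.
by exists phi; rewrite phiE -{1}[x]horner_algX aG horner_algX.
Qed.

Lemma gen_alg_iso A B h (x : B) (a : A) :
    (forall b, gen_alg x b) -> is_minpoly h x -> is_minpoly h a ->
  exists phi : {lrmorphism B -> A},
    [/\ injective phi, forall c, gen_alg a c <-> exists b, c = phi b
      & phi x = a].
Proof.
move=> gen_x hx ha.
have [phi phi_x] := gen_alg_lift gen_x hx (is_minpoly_root ha).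
have phiE g : phi (horner_alg x g) = horner_alg a g.
  by rewrite lrmorph_horner_alg phi_x.
exists phi; split=> // [|c].
  by apply: raddf_inj => b; have [g ->] := gen_x b; rewrite /= phiE => /ha/hx.
split=> [[g ->]|[b ->]]; first by exists (horner_alg x g).
by have [g ->] := gen_x b; exists g.
Qed.

Section QuotientPolynomial.
Variables (h : {poly K}).
Hypotheses (h_monic : h \is monic) (h_gt1 : (1 < size h)%N).

Lemma horner_alg_qX g : horner_alg ('qX : {poly %/ h}) g = in_qpoly h g.
Proof.
elim/poly_ind: g => [|g k IHg]; first by rewrite !rmorph0.
rewrite !(rmorphD, rmorphM) /= IHg horner_algX horner_algC -in_qpolyM.
by congr (_ + _); rewrite -in_qpoly1 -in_qpolyZ -mul_polyC mulr1.
Qed.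

Lemma gen_alg_qX (q : {poly %/ h}) : gen_alg 'qX q.
Proof.
exists (val q); rewrite horner_alg_qX; apply/val_inj.
by rewrite /= Pdiv.CommonRing.rmodp_small ?size_mk_monic.
Qed.

Lemma is_minpoly_qX : is_minpoly h ('qX : {poly %/ h}).
Proof.
move=> g; rewrite horner_alg_qX Pdiv.Idomain.dvdpE.
have hE : mk_monic h = h by rewrite /mk_monic h_gt1 h_monic.
rewrite -[0](rmorph0 (in_qpoly h)); split=> [/(congr1 val)/=|/eqP dvd].
  by rewrite hE Pdiv.CommonRing.rmod0p => /eqP.
by apply/val_inj; rewrite /= hE dvd Pdiv.CommonRing.rmod0p.
Qed.

Lemma quot_iso_gen_alg A (a : A) : is_minpoly h a -> quot_iso h (gen_alg a) a.
Proof. exact: gen_alg_iso gen_alg_qX is_minpoly_qX. Qed.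

Lemma has_Kdim_gen_alg A (a : A) d :
  size h = d.+1 -> is_minpoly h a -> has_Kdim (gen_alg a) d.
Proof.
move=> hd ha; exists (fun i => a ^+ i); split=> [i|_ [g ->]].
  by apply: subalgX; [apply: gen_alg_subalg | apply: gen_alg_self].
have rVpolyE (c : 'rV[K]_d) : \sum_i c 0 i *: a ^+ i = horner_alg a (rVpoly c).
  rewrite /rVpoly poly_def rmorph_sum /=; apply: eq_bigr => i _.
  by rewrite horner_algZ rmorphXn /= horner_algX valK.
have size_mod : (size (g %% h)%R <= d)%N.
  by rewrite -ltnS -hd ltn_modp monic_neq0.
exists (poly_rV (g %% h)); split=> [|c].
  by rewrite rVpolyE poly_rV_K // horner_alg_modp // is_minpoly_root.
rewrite rVpolyE => /eqP; rewrite -subr_eq0 -rmorphB => /eqP/ha dvd.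
apply: (can_inj (@rVpolyK _ _)); rewrite poly_rV_K //.
rewrite -[rVpoly c](@modp_small _ _ h); last by rewrite hd ltnS size_poly.
by apply/eqP; rewrite -subr_eq0 -modpN -modpD; apply: dvd.
Qed.

End QuotientPolynomial.
End GeneratedAlgebra.

(** * Elements with many translates *)

Lemma size_translate_sub (R : idomainType) (g : {poly R}) z : g != 0 ->
  (size (g \Po ('X + z%:P) - g)%R < size g)%N.
Proof.
move=> g_neq0; have size_g : size (g \Po ('X + z%:P)) = size g.
  by rewrite size_comp_poly2 ?size_XaddC.
rewrite -(prednK (n := size g)) ?size_poly_gt0 // ltnS; apply/leq_sizeP => j.
rewrite leq_eqVlt => /predU1P[<-|lt_j].
  rewrite coefB -{1}size_g -!lead_coefE lead_coef_comp ?size_XaddC //.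
  by rewrite lead_coefXaddC expr1n mulr1 subrr.
have le_j : (size g <= j)%N by case: (size g) lt_j.
by rewrite coefB !nth_default ?subrr ?size_g.
Qed.

Lemma poly_const_on (R : idomainType) (g : {poly R}) (rs : seq R) k :
    uniq rs -> (0 < size rs)%N -> (size g <= size rs)%N ->
  {in rs, forall z, g.[z] = k} -> g = k%:P.
Proof.
move=> rs_uniq rs_gt0 le_g gk; apply/subr0_eq/eqP; apply: contraT => nz.
have : (size rs < size (g - k%:P)%R)%N.
  apply: max_poly_roots => //; apply/allP => z /gk gz.
  by rewrite rootE !hornerE gz subrr.
rewrite ltnNge (leq_trans (size_polyD _ _)) // geq_max le_g size_polyN.
by rewrite (leq_trans (size_polyC_leq1 _)).
Qed.

Section Translates.
Variables (K : fieldType) (A : comAlgType K) (x : A) (Z : seq K).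

Lemma horner_alg_translate (phi : {lrmorphism A -> A}) z g :
  phi x = x + z%:A ->
  phi (horner_alg x g) = horner_alg x (g \Po ('X + z%:P)).
Proof.
move=> phi_x.
by rewrite lrmorph_horner_alg phi_x horner_alg_comp horner_alg_XaddC.
Qed.

Lemma translation_invariant_const (g : {poly K}) :
    uniq Z -> 0 \in Z -> (size g <= size Z)%N ->
  {in Z, forall z, g \Po ('X + z%:P) = g} -> g = (g.[0])%:P.
Proof.
move=> Z_uniq Z0 le_g g_inv; apply: (poly_const_on Z_uniq) => // [|z zZ].
  by case: Z Z0.
by rewrite -[in RHS](g_inv z zZ) horner_comp !hornerE.
Qed.

Hypotheses (Z_uniq : uniq Z) (Z0 : 0 \in Z).
Hypothesis x_translates : forall z, z \in Z ->
  exists phi : {lrmorphism A -> A}, phi x = x + z%:A.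

(* If [g] kills [x], so does [g(X + z) - g], which has smaller degree; hence a
   [g] of minimal degree is invariant under all these translations. *)
Lemma size_annihilator (g : {poly K}) :
  g != 0 -> horner_alg x g = 0 -> (size Z < size g)%N.
Proof.
elim: {g}(size g) {-2}g (leqnn (size g)) => [|m IHm] g.
  by rewrite leqn0 size_poly_eq0 => /eqP ->; rewrite eqxx.
move=> le_g g_neq0 gx; rewrite ltnNge; apply/negP => le_gZ.
have g_inv : {in Z, forall z, g \Po ('X + z%:P) = g}.
  move=> z zZ; have [phi phi_x] := x_translates zZ.
  have := size_translate_sub z g_neq0; set d := _ - g => lt_d.
  apply/subr0_eq/eqP; rewrite -/d; apply: contraT => d_neq0.
  rewrite -(ltn_geF (leq_trans lt_d le_gZ)) ltnW // IHm //.
    by rewrite -ltnS (leq_trans lt_d).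
  by rewrite rmorphB /= -(horner_alg_translate _ phi_x) gx rmorph0 subrr.
move: gx g_neq0; rewrite (translation_invariant_const Z_uniq Z0 le_gZ g_inv).
rewrite horner_algC polyC_eq0 => /eqP.
by rewrite (fmorph_eq0 (GRing.in_alg A)) => ->.
Qed.

Variable h : {poly K}.
Hypotheses (h_monic : h \is monic) (size_h : size h = (size Z).+1).
Hypothesis hx : horner_alg x h = 0.

Let size_modh (g : {poly K}) : (size (g %% h)%R <= size Z)%N.
Proof. by rewrite -ltnS -size_h ltn_modp monic_neq0. Qed.

Lemma translates_minpoly : is_minpoly h x.
Proof.
move=> g; split=> [gx|/dvdpP[q ->]]; last by rewrite rmorphM /= hx mulr0.
apply: contraT => ndvd; have := @size_annihilator (g %% h) ndvd.
by rewrite horner_alg_modp // => /(_ gx); rewrite ltnNge size_modh.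
Qed.

Lemma translates_fixed (y : A) : gen_alg x y ->
    (forall z (phi : {lrmorphism A -> A}),
       z \in Z -> phi x = x + z%:A -> phi y = y) ->
  exists k, y = k%:A.
Proof.
case=> g0 ->; rewrite -(horner_alg_modp g0 hx); move: (size_modh g0).
set g := g0 %% h => le_g y_fixed; exists g.[0].
rewrite {1}(@translation_invariant_const g) ?horner_algC // => z zZ.
have [-> | g_neq0] := eqVneq g 0; first by rewrite comp_poly0.
have [phi phi_x] := x_translates zZ; apply/subr0_eq/eqP; apply: contraT => nz.
have := size_annihilator nz; rewrite rmorphB /= -(horner_alg_translate _ phi_x).
rewrite (y_fixed z) // subrr => /(_ erefl).
by rewrite ltnNge (leq_trans (ltnW (size_translate_sub _ _))).
Qed.

End Translates.

(** * Splitting fields of affine polynomials *)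

Lemma irreducible_factor (F : fieldType) (q : {poly F}) : (1 < size q)%N ->
  exists2 g, irreducible_poly g & g %| q.
Proof.
move=> q_gt1; pose divisor_size m :=
  `[< exists g : {poly F}, [/\ (1 < size g)%N, g %| q & size g = m] >].
have ex_divisor : exists m, divisor_size m.
  by exists (size q); apply/asboolP; exists q.
case: (ex_minnP ex_divisor) => _ /asboolP[g [g_gt1 gq <-]] min_g.
exists g => //; split=> // r r_neq1 rg.
have g_neq0 : g != 0 by rewrite -size_poly_gt0 ltnW.
have r_neq0 : r != 0 by apply: contraTneq rg => ->; rewrite dvd0p.
rewrite -dvdp_size_eqp // eqn_leq dvdp_leq // min_g //; apply/asboolP.
exists r; split=> //; last exact: dvdp_trans rg gq.
by rewrite ltn_neqAle eq_sym r_neq1 size_poly_gt0.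
Qed.

Lemma gen_alg_adjoin (K : fieldType) (E : fieldExtType K) (y : E) :
  <<1; y>>%VS = fullv -> forall b : E, gen_alg y b.
Proof.
move=> yE b; have : b \in <<1%AS; y>>%VS by rewrite yE memvf.
by case/Fadjoin_polyP=> _ /polyOver1P[q ->] ->; exists q.
Qed.

Definition affine_poly (K : fieldType) (p n : nat) (a : 'I_n -> K) (k : K) :
    {poly K} :=
  span_poly p a - k%:P.

Section AffinePolynomial.
Variables (K : fieldType) (p : nat) (pcharK : p \in [pchar K]).
Variables (n : nat) (a : 'I_n -> K) (k : K).
Hypothesis a_moore : moore p a != 0.
Local Notation q := (affine_poly p a k).
Let p_gt0 := prime_gt0 (pcharf_prime pcharK).

Let size_polyC_lt_span_poly : (size (- k%:P)%R < size (span_poly p a))%N.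
Proof.
rewrite size_polyN (leq_ltn_trans (size_polyC_leq1 _)) //.
by rewrite size_span_poly // ltnS expn_gt0 p_gt0.
Qed.

Lemma size_affine_poly : size q = (p ^ n).+1.
Proof. by rewrite (size_polyDl size_polyC_lt_span_poly) size_span_poly. Qed.

Lemma monic_affine_poly : q \is monic.
Proof.
rewrite monicE (lead_coefDl size_polyC_lt_span_poly).
exact: monic_span_poly.
Qed.

Lemma horner_alg_affine (B : comAlgType K) (x : B) :
  horner_alg x q = horner_alg x (span_poly p a) - k%:A.
Proof. by rewrite rmorphB /= horner_algC. Qed.

Lemma horner_alg_affine_translate (B : comAlgType K) (x : B) z :
  z \in Fp_span p a -> horner_alg (x + z%:A) q = horner_alg x q.
Proof.
rewrite -root_span_poly // !horner_alg_affine span_poly_linearized // => /rootP.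
rewrite horner_linearized => z_root; rewrite !horner_alg_linearized.
under eq_bigr => m _.
  rewrite exprDn_pchar ?pchar_natX ?pchar_lalg // exprZn expr1n scalerDr.
  rewrite scalerA; over.
by rewrite big_split /= -scaler_suml z_root scale0r addr0.
Qed.

Let translates (L : fieldExtType K) (x : L) : seq L :=
  [seq x + z%:A | z <- Fp_span p a].

Let translates_uniq L x : uniq (@translates L x).
Proof.
rewrite map_inj_uniq ?undup_uniq // => y z /addrI.
exact: (fmorph_inj (GRing.in_alg L)).
Qed.

Lemma affine_poly_prod_XsubC (L : fieldExtType K) (x : L) :
  horner_alg x q = 0 -> map_poly (GRing.in_alg L) q
    = \prod_(y <- [seq x + z%:A | z <- Fp_span p a]) ('X - y%:P).
Proof.
move=> qx; rewrite [LHS](@all_roots_prod_XsubC _ _ (translates x)).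
- by rewrite lead_coef_map (monicP monic_affine_poly) rmorph1 scale1r.
- by rewrite size_map_poly size_affine_poly size_map size_Fp_span_moore.
- apply/allP => _ /mapP[z zZ ->]; apply/rootP.
  by rewrite -qx -(horner_alg_affine_translate x zZ).
by rewrite uniq_rootsE translates_uniq.
Qed.

Lemma affine_poly_splittingFieldFor (L : fieldExtType K) (x : L) :
  horner_alg x q = 0 -> <<1; x>>%VS = fullv ->
  splittingFieldFor 1 (map_poly (GRing.in_alg L) q) {:L}.
Proof.
move=> qx gen_x; exists (translates x).
  by rewrite (affine_poly_prod_XsubC qx) eqpxx.
apply/eqP; rewrite eqEsubv subvf -gen_x /=; apply/FadjoinP; split.
  exact: subv_adjoin_seq.
apply: seqv_sub_adjoin; apply/mapP; exists 0; first exact: Fp_span0.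
by rewrite scale0r addr0.
Qed.

Lemma affine_poly_galois (g : {poly K}) : irreducible_poly g -> g %| q ->
  exists (E : splittingFieldType K) (x : E),
    [/\ horner_alg x g = 0, forall b, gen_alg x b, galois 1%AS {:E}
      & #|'Gal({:E} / 1%AS)%g| = (size g).-1].
Proof.
move=> irr_g /dvdpP[r qE].
have [L dimL [x /rootP gx gen_x]] := irredp_FAdjoin irr_g.
have qx : horner_alg x q = 0 by rewrite qE rmorphM /= [X in _ * X]gx mulr0.
have q_over : map_poly (GRing.in_alg L) q \is a polyOver 1%VS.
  by apply/polyOver1P; exists q.
have q_split := affine_poly_splittingFieldFor qx gen_x.
have splitL : SplittingField.axiom L by exists (map_poly (GRing.in_alg L) q).
pose E : splittingFieldType K :=
  HB.pack L (FieldExt_isSplittingField.Build K L splitL).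
have galE : galois 1%AS {:E}.
  apply/splitting_galoisField; exists (map_poly (GRing.in_alg L) q); split=> //.
  by rewrite (affine_poly_prod_XsubC qx) separable_prod_XsubC translates_uniq.
exists E, x; split=> //; first exact: gen_alg_adjoin gen_x.
by rewrite -galois_dim // dimv1 divn1 dimL.
Qed.

Lemma affine_poly_minpoly (A : comAlgType K) (x : A) :
    (forall e : 'rV['F_p]_n,
       exists phi : {lrmorphism A -> A}, phi x = x + (Fp_comb e a)%:A) ->
    horner_alg x q = 0 ->
  is_minpoly q x.
Proof.
move=> x_translates; apply: (@translates_minpoly _ _ _ (Fp_span p a)).
- exact: undup_uniq.
- exact: Fp_span0.
- by move=> _ /Fp_spanP[e ->].
- exact: monic_affine_poly.
by rewrite size_affine_poly size_Fp_span_moore.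
Qed.

End AffinePolynomial.

Lemma AS_Q_affine (K : fieldType) (p : nat) (pcharK : p \in [pchar K]) n
    (f : 'I_n.+1 -> K) : moore p f != 0 ->
  AS_Q p f = affine_poly p (moore_cofactor p f) (moore p f ^+ (p ^ n)).
Proof.
move=> f_moore; rewrite /AS_Q -/(moore_poly p (hat_moore p f)).
have hat_neq0 := hat_moore_moore_neq0 pcharK f_moore.
rewrite moore_poly_span_poly // scalerK //; congr (_ - _).
exact/esym/eq_span_poly/Fp_span_moore_cofactor.
Qed.

Section ArtinSchreierPolynomial.
Variables (K : fieldType) (p : nat) (pcharK : p \in [pchar K]).

Lemma moore1_neq0 : moore p (fun _ : 'I_1 => 1 : K) != 0.
Proof. by rewrite /moore det_mx11 mxE oner_eq0. Qed.

Lemma AS_poly_affine (k : K) :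
  'X^p - 'X - k%:P = affine_poly p (fun _ : 'I_1 => 1) k.
Proof.
congr (_ - _); have p_gt1 := prime_gt1 (pcharf_prime pcharK).
have lt_X : (size (- 'X : {poly K})%R < size ('X^p : {poly K}))%N.
  by rewrite size_polyN size_polyX size_polyXn ltnS.
rewrite [LHS](@all_roots_prod_XsubC _ _ (Fp_span p (fun _ : 'I_1 => 1))).
- by rewrite lead_coefDl // lead_coefXn scale1r.
- by rewrite size_polyDl // size_polyXn size_Fp_span_moore ?moore1_neq0.
- apply/allP => _ /Fp_spanP[e ->]; rewrite rootE !hornerE subr_eq0.
  rewrite Fp_comb_expr ?pchar_nat //; apply/eqP/eq_bigr => i _.
  by rewrite expr1n.
by rewrite uniq_rootsE undup_uniq.
Qed.

Lemma size_AS_poly (k : K) : size ('X^p - 'X - k%:P) = p.+1.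
Proof. by rewrite AS_poly_affine size_affine_poly ?moore1_neq0 ?expn1. Qed.

Lemma monic_AS_poly (k : K) : 'X^p - 'X - k%:P \is monic.
Proof. by rewrite AS_poly_affine monic_affine_poly ?moore1_neq0. Qed.

End ArtinSchreierPolynomial.

(** * The Artin-Schreier algebra and its primitive element *)

Section ArtinSchreierAlgebra.
Variables (K : fieldType) (p : nat) (pcharK : p \in [pchar K]).
Variables (n : nat) (f : 'I_n -> K).
Local Notation A := (AS_alg pcharK f).
Local Notation w_ := (AS_gen pcharK f).
Local Notation pi := (AS_pi pcharK f).
Local Notation repr a :=
  (generic_quotient.repr (a : {ideal_quot (AS_ideal pcharK f)})).

Lemma AS_alg_pchar : p \in [pchar A].
Proof. by rewrite pchar_lalg. Qed.

Fact AS_pi_is_nmod_morphism : nmod_morphism pi.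
Proof. by split=> [|g h]; rewrite /AS_pi ?rmorph0 ?rmorphD. Qed.

Fact AS_pi_is_monoid_morphism : monoid_morphism pi.
Proof. by split=> [|g h]; rewrite /AS_pi ?rmorph1 ?rmorphM. Qed.

HB.instance Definition _ :=
  GRing.isNmodMorphism.Build {mpoly K[n]} A pi AS_pi_is_nmod_morphism.
HB.instance Definition _ :=
  GRing.isMonoidMorphism.Build {mpoly K[n]} A pi AS_pi_is_monoid_morphism.

Fact AS_pi_is_scalable : scalable pi.
Proof. by move=> k g; rewrite -mul_mpolyC rmorphM. Qed.

HB.instance Definition _ :=
  GRing.isScalable.Build K {mpoly K[n]} A *:%R pi AS_pi_is_scalable.

Lemma AS_pi_repr (a : A) : pi (repr a) = a.
Proof. by rewrite /AS_pi reprK. Qed.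

Lemma AS_pi_eq0 g : (pi g == 0) = (g \in AS_ideal pcharK f).
Proof. by rewrite -(rmorph0 pi) /AS_pi -Quotient.idealrBE subr0. Qed.

Lemma AS_gen_equation k : w_ k ^+ p - w_ k = (f k)%:A.
Proof.
apply/eqP; rewrite -subr_eq0.
have -> : (f k)%:A = pi (f k)%:MP by rewrite -[LHS]/(pi _ * 1) mulr1.
rewrite -rmorphXn -!rmorphB AS_pi_eq0; apply/asboolP.
exists (fun j => (j == k)%:R); rewrite (bigD1 k) //= big1 => [|j /negPf ->].
  by rewrite eqxx mul1r addr0.
by rewrite mul0r.
Qed.

Lemma AS_alg_gen_ind (V : A -> Prop) :
  is_subalg V -> (forall k, V (w_ k)) -> forall a, V a.
Proof.
move=> V_subalg Vw a; rewrite -[a]AS_pi_repr (mpolyE (repr a)) rmorph_sum.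
apply: subalg_sum => // m _ /=; rewrite linearZ; apply: subalgZ => //.
rewrite mpolyXE_id rmorph_prod; case: (V_subalg) => V1 _ VM.
apply: big_ind => // i _; rewrite /= rmorphXn.
exact: (subalgX V_subalg _ (Vw i)).
Qed.

Lemma AS_lrmorph_ext (B : comAlgType K) (phi psi : {lrmorphism A -> B}) :
  (forall k, phi (w_ k) = psi (w_ k)) -> phi =1 psi.
Proof.
move=> eq_gen; apply: (AS_alg_gen_ind (V := fun a => phi a = psi a)) => //.
split=> [|k a b eq_a eq_b|a b eq_a eq_b]; first by rewrite !rmorph1.
  by rewrite !linearP /= eq_a eq_b.
by rewrite !rmorphM /= eq_a eq_b.
Qed.

Lemma AS_alg_lift (B : comAlgType K) (b : 'I_n -> B) :
  (forall k, b k ^+ p - b k = (f k)%:A) ->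
  exists phi : {lrmorphism A -> B}, forall k, phi (w_ k) = b k.
Proof.
move=> b_equation; pose ev := mmap (GRing.in_alg B) b.
have evZ k g : ev (k *: g) = k *: ev g by rewrite /ev mmapZ mulr_algl.
have ev_repr g : ev (repr (pi g)) = ev g.
  apply/subr0_eq; rewrite -rmorphB.
  have : repr (pi g) - g \in AS_ideal pcharK f.
    by rewrite -AS_pi_eq0 rmorphB /= AS_pi_repr subrr.
  case/asboolP=> h ->; rewrite rmorph_sum big1 //= => k _.
  rewrite rmorphM !rmorphB rmorphXn /= mmapX mmap1U mmapC b_equation.
  by rewrite subrr mulr0.
have [||phi phiE] := @lrmorphism_of K B A (fun a => ev (repr a)).
- move=> k x y; rewrite -{1}[x]AS_pi_repr -{1}[y]AS_pi_repr -linearP ev_repr.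
  by rewrite [LHS]rmorphD /= -/ev evZ.
- split=> [|x y]; first by rewrite -(rmorph1 pi) ev_repr [LHS]rmorph1.
  by rewrite -{1}[x]AS_pi_repr -{1}[y]AS_pi_repr -rmorphM ev_repr [LHS]rmorphM.
by exists phi => k; rewrite phiE ev_repr /ev /= mmapX mmap1U.
Qed.

Lemma AS_gen_expr j k :
  w_ j ^+ (p ^ k) = w_ j + (\sum_(i < k) f j ^+ (p ^ i))%:A.
Proof.
elim: k => [|k IHk]; first by rewrite big_ord0 scale0r addr0.
have w_p : w_ j ^+ p = w_ j + (f j)%:A by rewrite -AS_gen_equation addrC subrK.
rewrite expnSr exprM IHk exprDn_pchar ?pchar_nat ?AS_alg_pchar // w_p -addrA.
congr (_ + _); rewrite big_ord_recl /= expr1 scalerDl; congr (_ + _).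
rewrite exprZn expr1n expr_sum_pchar ?pchar_nat //; congr (_ *: 1).
by apply: eq_bigr => i _; rewrite -exprM -expnSr.
Qed.

End ArtinSchreierAlgebra.

Lemma invmx_scale_sumK (K : fieldType) (V : lmodType K) m (M : 'M[K]_m)
    (v : 'I_m -> V) i : M \in unitmx ->
  \sum_k invmx M i k *: (\sum_j M k j *: v j) = v i.
Proof.
move=> uM; have entryE j :
    \sum_k invmx M i k *: (M k j *: v j) = (i == j)%:R *: v j.
  have /matrixP/(_ i j) := mulVmx uM; rewrite !mxE => <-.
  by rewrite scaler_suml; apply: eq_bigr => k _; rewrite scalerA.
under eq_bigr do rewrite scaler_sumr.
rewrite exchange_big (bigD1 i) //= entryE eqxx scale1r big1 ?addr0 // => j ne_j.
by rewrite entryE eq_sym (negPf ne_j) scale0r.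
Qed.

Section PrimitiveElement.
Variables (K : fieldType) (p : nat) (pcharK : p \in [pchar K]).
Variables (n : nat) (f : 'I_n.+1 -> K).
Hypothesis f_moore : moore p f != 0.
Local Notation A := (AS_alg pcharK f).
Local Notation w := (AS_w pcharK f).
Local Notation w_ := (AS_gen pcharK f).
Local Notation cof := (moore_cofactor p f).

Lemma AS_w_cofactor : w = \sum_j cof j *: w_ j.
Proof.
rewrite /AS_w (expand_det_row _ ord0); apply: eq_bigr => j _.
rewrite mxE /= /cofactor /moore_cofactor -scalerA mulrC.
transitivity ((-1) ^+ (0 + j) * (hat_moore p f j)%:A * w_ j).
  congr (_ * _ * _); rewrite -[_%:A]/(GRing.in_alg A _) -det_map_mx.
  by congr (\det _); apply/matrixP=> a b; rewrite !mxE.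
rewrite -mulrA mulr_algl -[RHS]mulr_algl; congr (_ * _).
by rewrite -[RHS]/(GRing.in_alg A _) rmorph_sign.
Qed.

Definition moore_pairing_sum (k : nat) : K :=
  \sum_(i < k) moore_pairing p f k i.

Lemma AS_w_expr k :
  w ^+ (p ^ k) = \sum_j cof j ^+ (p ^ k) *: w_ j + (moore_pairing_sum k)%:A.
Proof.
rewrite AS_w_cofactor expr_sum_pchar ?pchar_natX ?AS_alg_pchar //.
under eq_bigr do rewrite exprZn AS_gen_expr scalerDr scalerA.
rewrite big_split /= -scaler_suml; congr (_ + _ *: 1).
by under eq_bigr do rewrite mulr_sumr; rewrite exchange_big.
Qed.

Lemma gen_AS_w (a : A) : gen_alg w a.
Proof.
have gen_subalg := gen_alg_subalg w.
apply: AS_alg_gen_ind a => // j.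
have uM : moore_mx p cof \in unitmx.
  by rewrite unitmxE unitfE; apply: moore_cofactor_moore_neq0.
rewrite -(invmx_scale_sumK w_ j uM); apply: subalg_sum => // k _.
apply: subalgZ => //; exists ('X^(p ^ k) - (moore_pairing_sum k)%:P).
rewrite rmorphB rmorphXn /= horner_algX horner_algC AS_w_expr addrK.
by apply: eq_bigr => i _; rewrite mxE.
Qed.

Local Notation c := (span_coef p cof).
Let cof_moore := moore_cofactor_moore_neq0 pcharK f_moore.

Let span_coef_cofactor j : \sum_(k < n.+2) c k * cof j ^+ (p ^ k) = 0.
Proof. by rewrite sum_span_coef ?mem_Fp_span. Qed.

Lemma sum_span_coef_pairing_sum :
  \sum_(k < n.+2) c k * moore_pairing_sum k = moore p f ^+ (p ^ n).
Proof.
have span_coef_pairing0 i : \sum_(k < n.+2) c k * moore_pairing p f k i = 0.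
  under eq_bigr do rewrite mulr_sumr; rewrite exchange_big big1 //= => j _.
  under eq_bigr do rewrite mulrA.
  by rewrite -mulr_suml span_coef_cofactor mul0r.
transitivity (\sum_(i < n.+1) \sum_(k < n.+2 | (i < k)%N)
                c k * moore_pairing p f k i).
  rewrite (exchange_big_dep xpredT) //=; apply: eq_bigr => k _.
  by rewrite -mulr_sumr /moore_pairing_sum (big_ord_widen n.+1) // -ltnS.
rewrite big_ord_recr /= big1 ?add0r => [|i _].
  rewrite (bigD1 ord_max) //= span_coef_last // mul1r moore_pairing_pred //.
  rewrite big1 ?addr0 // => k; rewrite -val_eqE /=.
  by have := ltn_ord k; lia.
rewrite big_rmcond ?span_coef_pairing0 // => k le_k.
by rewrite moore_pairing_eq0 ?mulr0 //; have := ltn_ord i; lia.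
Qed.

Lemma AS_w_root : horner_alg w (AS_Q p f) = 0.
Proof.
rewrite AS_Q_affine // horner_alg_affine span_poly_linearized //.
rewrite horner_alg_linearized.
under eq_bigr do rewrite AS_w_expr scalerDr scalerA.
rewrite big_split /= -scaler_suml sum_span_coef_pairing_sum addrK.
under eq_bigr do rewrite scaler_sumr; rewrite exchange_big big1 //= => j _.
under eq_bigr do rewrite scalerA.
by rewrite -scaler_suml span_coef_cofactor scale0r.
Qed.

End PrimitiveElement.

(** * Shifts of the Artin-Schreier generators *)

Section Shifts.
Variables (K : fieldType) (p : nat) (pcharK : p \in [pchar K]).
Variables (n : nat) (f : 'I_n -> K).
Local Notation A := (AS_alg pcharK f).
Local Notation pcharA := (AS_alg_pchar pcharK f).
Local Notation w_ eps := (Fp_comb eps (AS_gen pcharK f)).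
Implicit Types a e eps : 'rV['F_p]_n.

Lemma AS_shift_exists a :
  exists s : {lrmorphism A -> A},
    forall k, s (AS_gen pcharK f k) = AS_gen pcharK f k + natrFp pcharA (a 0 k).
Proof.
apply: AS_alg_lift => k; rewrite AS_operatorD ?AS_alg_pchar // AS_gen_equation.
by rewrite natrFp_expr ?pchar_nat ?AS_alg_pchar // subrr addr0.
Qed.

Definition AS_shift a : {lrmorphism A -> A} := projT1 (cid (AS_shift_exists a)).

Lemma AS_shift_gen a k :
  AS_shift a (AS_gen pcharK f k) = AS_gen pcharK f k + natrFp pcharA (a 0 k).
Proof. exact: (projT2 (cid (AS_shift_exists a))). Qed.

Lemma AS_shift0 : AS_shift 0 =1 id.
Proof.
apply: (AS_lrmorph_ext (psi := idfun)) => k.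
by rewrite AS_shift_gen mxE rmorph0 addr0.
Qed.

Lemma AS_shiftD a b : AS_shift (a + b) =1 AS_shift a \o AS_shift b.
Proof.
apply: (AS_lrmorph_ext (psi := AS_shift a \o AS_shift b)) => k /=.
rewrite !AS_shift_gen rmorphD /= AS_shift_gen mxE rmorphD.
by rewrite (rmorph_natrFp _ _ pcharA) addrA.
Qed.

Lemma AS_shiftNK a : cancel (AS_shift (- a)) (AS_shift a).
Proof.
by move=> x; rewrite -[LHS](AS_shiftD a (- a)) subrr AS_shift0.
Qed.

Lemma AS_shift_inj a b : AS_shift a =1 AS_shift b -> a = b.
Proof.
move=> ab; apply/rowP=> k; apply: (fmorph_inj (natrFp pcharA)).
by have := ab (AS_gen pcharK f k); rewrite !AS_shift_gen => /addrI.
Qed.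

Lemma is_Kaut_AS_shift a : is_Kaut (AS_shift a).
Proof.
split; last by exists (AS_shift a).
exists (AS_shift (- a)); last exact: AS_shiftNK.
by rewrite -{1}[a]opprK; apply: AS_shiftNK.
Qed.

Lemma AS_shift_comb a eps :
  AS_shift a (w_ eps) = w_ eps + natrFp pcharA (dot_row a eps).
Proof. exact: Fp_comb_translate (rmorphD _) (AS_shift_gen a). Qed.

Lemma AS_comb_equation eps : w_ eps ^+ p - w_ eps = (Fp_comb eps f)%:A.
Proof. exact: Fp_comb_AS_equation (AS_gen_equation pcharK f). Qed.

Lemma AS_comb_minpoly eps : eps != 0 ->
  is_minpoly ('X^p - 'X - (Fp_comb eps f)%:P) (w_ eps).
Proof.
move=> eps_neq0; rewrite (AS_poly_affine pcharK).
apply: affine_poly_minpoly => [||c|]; rewrite ?moore1_neq0 //.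
  have [a ac] := dot_row_surj (c 0 0) eps_neq0; exists (AS_shift a).
  rewrite AS_shift_comb ac (Fp_combE pcharK) big_ord1 mulr1.
  by rewrite -(rmorph_natrFp (GRing.in_alg A) pcharK).
rewrite -AS_poly_affine // !rmorphB rmorphXn /= horner_algX horner_algC.
by rewrite AS_comb_equation subrr.
Qed.

Lemma AS_comb_gen_alg eps : eps != 0 ->
  [/\ w_ eps ^+ p - w_ eps = (Fp_comb eps f)%:A,
      quot_iso ('X^p - 'X - (Fp_comb eps f)%:P) (gen_alg (w_ eps)) (w_ eps),
      is_subalg (gen_alg (w_ eps))
    & has_Kdim (gen_alg (w_ eps)) p].
Proof.
move=> /AS_comb_minpoly min_w; have p_gt0 := prime_gt0 (pcharf_prime pcharK).
have h_monic := monic_AS_poly pcharK (Fp_comb eps f).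
have size_h := size_AS_poly pcharK (Fp_comb eps f).
split; first exact: AS_comb_equation.
- by apply: quot_iso_gen_alg; rewrite // size_h ltnS.
- exact: gen_alg_subalg.
- exact: has_Kdim_gen_alg min_w.
Qed.

Lemma gen_alg_AS_combZ c eps (b : A) : c != 0 ->
  gen_alg (w_ (c *: eps)) b <-> gen_alg (w_ eps) b.
Proof.
have sub d e : gen_alg (w_ e) (w_ (d *: e)).
  exists (natrFp pcharK d *: 'X); rewrite horner_algZ horner_algX.
  rewrite (Fp_combZ pcharA) -(rmorph_natrFp (GRing.in_alg A) pcharK).
  by rewrite /= mulr_algl.
move=> c_neq0; split; apply: gen_alg_trans; first exact: sub.
by rewrite -{2}[eps](scalerK c_neq0); apply: sub.
Qed.

Lemma gen_alg_AS_comb_proportional e e' : e != 0 ->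
  gen_alg (w_ e) (w_ e') -> exists c, e' = c *: e.
Proof.
move=> e_neq0 [g gE]; apply: dot_row_proportional => // a ae.
have := AS_shift_comb a e'; rewrite gE lrmorph_horner_alg AS_shift_comb ae.
rewrite rmorph0 addr0 => /eqP; rewrite -subr_eq0 opprD addNKr oppr_eq0.
by rewrite fmorph_eq0 => /eqP.
Qed.

End Shifts.

Section ShiftsOfPrimitiveElement.
Variables (K : fieldType) (p : nat) (pcharK : p \in [pchar K]).
Variables (n : nat) (f : 'I_n.+1 -> K).
Hypothesis f_moore : moore p f != 0.
Local Notation A := (AS_alg pcharK f).
Local Notation w := (AS_w pcharK f).
Local Notation cof := (moore_cofactor p f).
Let cof_moore := moore_cofactor_moore_neq0 pcharK f_moore.
Let p_gt0 := prime_gt0 (pcharf_prime pcharK).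

Lemma AS_shift_w a : AS_shift pcharK f a w = w + (Fp_comb a cof)%:A.
Proof.
rewrite !AS_w_cofactor linear_sum (Fp_combE pcharK) scaler_suml -big_split.
apply: eq_bigr => j _ /=; rewrite linearZ /= AS_shift_gen scalerDr.
by rewrite -(rmorph_natrFp (GRing.in_alg A) pcharK) /= scalerA mulrC.
Qed.

Lemma size_AS_Q : size (AS_Q p f) = (p ^ n.+1).+1.
Proof. by rewrite AS_Q_affine // size_affine_poly. Qed.

Lemma monic_AS_Q : AS_Q p f \is monic.
Proof. by rewrite AS_Q_affine // monic_affine_poly. Qed.

Lemma AS_w_minpoly : is_minpoly (AS_Q p f) w.
Proof.
have := AS_w_root pcharK f_moore; rewrite AS_Q_affine //.
apply: affine_poly_minpoly => // a.
by exists (AS_shift pcharK f a); apply: AS_shift_w.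
Qed.

Lemma quot_iso_AS_w : quot_iso (AS_Q p f) (fun _ : A => True) w.
Proof.
have [|phi [phi_inj phiP phi_w]] := quot_iso_gen_alg monic_AS_Q _ AS_w_minpoly.
  by rewrite size_AS_Q ltnS expn_gt0 p_gt0.
by exists phi; split=> // b; split=> // _; apply/phiP/gen_AS_w.
Qed.

Lemma AS_shift_fixed (x : A) :
  (forall a, AS_shift pcharK f a x = x) -> exists k, x = k%:A.
Proof.
move=> x_fixed; have gen_x := gen_AS_w f_moore x.
apply: (@translates_fixed _ _ w (Fp_span p cof) _ _ _ (AS_Q p f)) (gen_x) _.
- exact: undup_uniq.
- exact: Fp_span0.
- move=> _ /Fp_spanP[a ->].
  by exists (AS_shift pcharK f a); apply: AS_shift_w.
- exact: monic_AS_Q.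
- by rewrite size_AS_Q size_Fp_span_moore.
- exact: AS_w_root.
move=> _ phi /Fp_spanP[a ->] phi_w; rewrite -[RHS](x_fixed a).
have [g ->] := gen_x; rewrite !lrmorph_horner_alg phi_w.
by rewrite AS_shift_w.
Qed.

End ShiftsOfPrimitiveElement.

(** * The image of [x ^+ p - x] and the field case *)

Section ArtinSchreierImage.
Variables (K : fieldType) (p : nat) (pcharK : p \in [pchar K]).

Lemma AS_image0 : AS_image p (0 : K).
Proof. by exists 0; rewrite expr0n_pchar ?pchar_nat // subrr. Qed.

Lemma AS_imageD (x y : K) : AS_image p x -> AS_image p y -> AS_image p (x + y).
Proof. by move=> [u ->] [v ->]; exists (u + v); rewrite AS_operatorD. Qed.

Lemma AS_imageN (x : K) : AS_image p x -> AS_image p (- x).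
Proof.
move=> [u ->]; exists (- u); rewrite exprNn_pchar ?pchar_nat //.
by rewrite opprB opprK addrC.
Qed.

Lemma AS_imageDl (x y : K) :
  AS_image p x -> AS_image p (x + y) <-> AS_image p y.
Proof.
move=> xW; split=> [|yW]; last exact: AS_imageD.
by move=> xyW; rewrite -[y](addKr x); apply: AS_imageD => //; apply: AS_imageN.
Qed.

Lemma AS_image_comb n (c : 'rV['F_p]_n) (v : 'I_n -> K) :
  (forall i, AS_image p (v i)) -> AS_image p (Fp_comb c v).
Proof.
case/choice=> u uE; exists (Fp_comb c u).
rewrite (morph_Fp_comb _ _ (AS_operatorD pcharK)); apply: eq_bigr => i _.
by rewrite uE.
Qed.

Definition AS_independent n (f : 'I_n -> K) : Prop :=
  forall eps : 'rV['F_p]_n, AS_image p (Fp_comb eps f) -> eps = 0.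

Definition AS_image_span n (f : 'I_n -> K) (x : K) : Prop :=
  exists eps : 'rV['F_p]_n, AS_image p (x - Fp_comb eps f).

Lemma Fp_quot_dim_mx n (f : 'I_n -> K) r :
    has_Fp_quot_dim p (AS_image_span f) (AS_image p) r ->
  exists2 M : 'M['F_p]_(n, r), row_full M &
    forall eps, AS_image p (Fp_comb eps f) <-> eps *m M = 0.
Proof.
case=> b [/choice[e eP] bU].
have b_free (c : 'rV['F_p]_r) : AS_image p (Fp_comb c b) -> c = 0.
  have [|c0 [_ c0U]] := bU 0.
    by exists 0; rewrite (Fp_comb0 pcharK) subrr; apply: AS_image0.
  have c0E d : AS_image p (Fp_comb d b) -> c0 = d.
    by move=> dW; apply: c0U; rewrite sub0r; apply: AS_imageN.
  by move/c0E=> <-; apply: c0E; rewrite (Fp_comb0 pcharK); apply: AS_image0.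
have /choice[m mP] i : exists c : 'rV['F_p]_r, AS_image p (f i - Fp_comb c b).
  have [|c [cP _]] := bU (f i); last by exists c.
  exists (delta_mx 0 i); rewrite (Fp_comb_delta pcharK) subrr; exact: AS_image0.
pose M := \matrix_i m i.
have comb_mulM (eps : 'rV['F_p]_n) :
    AS_image p (Fp_comb eps f - Fp_comb (eps *m M) b).
  rewrite (Fp_comb_mulmx pcharK) /Fp_comb -sumrB.
  under eq_bigr do rewrite -mulrnBl rowK.
  exact: AS_image_comb.
have ME eps : AS_image p (Fp_comb eps f) <-> eps *m M = 0.
  rewrite -[Fp_comb eps f](subrK (Fp_comb (eps *m M) b)) AS_imageDl //.
  by split=> [/b_free//|->]; rewrite (Fp_comb0 pcharK); apply: AS_image0.
exists M => //; apply/row_fullP; exists (\matrix_j e j).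
apply/row_matrixP=> j; rewrite row_mul rowK row1; apply/esym/subr0_eq/b_free.
rewrite (Fp_combB pcharK) (Fp_comb_delta pcharK).
by rewrite -(subrKA (Fp_comb (e j) f)); apply: AS_imageD.
Qed.

Lemma Fp_quot_dim_independent n (f : 'I_n -> K) r :
    has_Fp_quot_dim p (AS_image_span f) (AS_image p) r ->
  r = n <-> AS_independent f.
Proof.
case/Fp_quot_dim_mx=> M /eqP rankM ME.
have -> : r = n <-> row_free M by rewrite /row_free rankM; split=> /eqP.
rewrite -kermx_eq0; split=> [/rowV0P kerM eps /ME eM|indep].
  by apply: kerM; apply/sub_kermxP.
by apply/rowV0P=> e /sub_kermxP/ME; apply: indep.
Qed.

End ArtinSchreierImage.

Lemma AS_root_translate (R : comNzRingType) (p : nat) (pcharR : p \in [pchar R])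
    (x y : R) : GRing.integral_domain_axiom R ->
  x ^+ p - x = y ^+ p - y -> exists c : 'F_p, y = x + natrFp pcharR c.
Proof.
move=> R_domain xy.
have [|c cE] := pFrobenius_fixed pcharR (x := y - x) R_domain.
  have -> : (y - x) ^+ p = (x ^+ p - x + y) - x ^+ p.
    by rewrite exprBn_pchar ?pchar_nat // xy subrK.
  by rewrite addrAC [x ^+ p - x]addrC addrK addrC.
by exists c; rewrite -cE addrC subrK.
Qed.

Lemma Fp_closed_subset_full (p n : nat) (S : {set 'rV['F_p]_n}) : prime p ->
    0 \in S -> {in S &, forall a b, a + b \in S} ->
    (forall e, e != 0 -> exists2 a, a \in S & dot_row a e != 0) ->
  S = setT.
Proof.
move=> p_pr S0 SD S_separates; apply/setP=> a; rewrite inE.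
pose M := \matrix_(i < #|S|) (enum_val i : 'rV['F_p]_n).
have M_full : row_full M.
  suff : row_free M^T by rewrite /row_free /row_full mxrank_tr.
  rewrite -kermx_eq0; apply/rowV0P => e /sub_kermxP eM.
  apply/eqP; apply: contraT => /S_separates[b Sb]; case/eqP.
  have /rowP/(_ (enum_rank_in Sb b)) := eM; rewrite !mxE => <-.
  rewrite dot_rowE; apply: eq_bigr => i _.
  by rewrite !mxE enum_rankK_in // mulrC.
have SZ (c : 'F_p) b : b \in S -> c *: b \in S.
  move=> Sb; rewrite -[c]natr_Zp scaler_nat; elim: (nat_of_ord c) => // m IHm.
  by rewrite mulrS SD.
have /submxP[c ->] := submx_full a M_full; rewrite mulmx_sum_row.
by apply: (big_ind (fun b => b \in S)) => // i _; rewrite rowK SZ ?enum_valP.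
Qed.

Lemma galois_fixed_base (K : fieldType) (E : splittingFieldType K) (x : E) :
    galois 1%AS {:E} ->
    {in 'Gal({:E} / 1%AS)%g, forall s : gal_of {:E}, s x = x} ->
  exists k, x = k%:A.
Proof.
move=> galE x_fixed; apply/vlineP; rewrite -(galois_fixedField galE).
by apply/fixedFieldP => //; apply: memvf.
Qed.

Section ArtinSchreierGalois.
Variables (K : fieldType) (p : nat) (pcharK : p \in [pchar K]).
Variables (n : nat) (f : 'I_n -> K) (E : splittingFieldType K) (y : 'I_n -> E).
Hypotheses (galE : galois 1%AS {:E}) (f_indep : AS_independent p f).
Hypothesis y_equation : forall j, y j ^+ p - y j = (f j)%:A.
Let pcharE : p \in [pchar E]. Proof. by rewrite pchar_lalg. Qed.

Lemma gal_shift_exists (s : gal_of {:E}) :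
  exists a : 'rV['F_p]_n, forall j, s (y j) = y j + natrFp pcharE (a 0 j).
Proof.
have /choice[c cP] j : exists c : 'F_p, s (y j) = y j + natrFp pcharE c.
  apply: AS_root_translate => [u v /eqP|]; first by rewrite mulf_eq0.
  by rewrite -rmorphXn -rmorphB /= y_equation rmorph_alg.
by exists (\row_j c j) => j; rewrite mxE.
Qed.

Definition gal_shift (s : gal_of {:E}) : 'rV['F_p]_n :=
  projT1 (cid (gal_shift_exists s)).

Lemma gal_shiftE (s : gal_of {:E}) j :
  s (y j) = y j + natrFp pcharE (gal_shift s 0 j).
Proof. exact: (projT2 (cid (gal_shift_exists s))). Qed.

Lemma gal_shift_eq (s : gal_of {:E}) (a : 'rV['F_p]_n) :
  (forall j, s (y j) = y j + natrFp pcharE (a 0 j)) -> gal_shift s = a.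
Proof.
move=> sa; apply/rowP=> j; apply: (fmorph_inj (natrFp pcharE)).
by apply: (addrI (y j)); rewrite -gal_shiftE.
Qed.

Lemma gal_shift1 : gal_shift 1%g = 0.
Proof. by apply: gal_shift_eq => j; rewrite gal_id mxE rmorph0 addr0. Qed.

Lemma gal_shiftM s t : gal_shift (s * t)%g = gal_shift s + gal_shift t.
Proof.
apply: gal_shift_eq => j; rewrite galM ?memvf // gal_shiftE rmorphD /=.
by rewrite gal_shiftE (rmorph_natrFp _ _ pcharE) mxE rmorphD addrAC addrA.
Qed.

Lemma gal_shift_comb (s : gal_of {:E}) (e : 'rV['F_p]_n) :
  s (Fp_comb e y) = Fp_comb e y + natrFp pcharE (dot_row (gal_shift s) e).
Proof. exact: Fp_comb_translate (rmorphD _) (gal_shiftE s). Qed.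

(* A combination of the [y j] that is fixed by the Galois group lies in [K]. *)
Lemma gal_shift_separates (e : 'rV['F_p]_n) : e != 0 ->
  exists2 s, s \in 'Gal({:E} / 1%AS)%g & dot_row (gal_shift s) e != 0.
Proof.
move=> e_neq0; apply: contrapT => no_sep; case/eqP: e_neq0; apply: f_indep.
have [|k ye] := @galois_fixed_base K E (Fp_comb e y) galE.
  move=> s sG; rewrite gal_shift_comb; suff -> : dot_row (gal_shift s) e = 0.
    by rewrite rmorph0 addr0.
  by apply/eqP; apply: contraT => nz; case: no_sep; exists s.
exists k; apply: (fmorph_inj (GRing.in_alg E)); rewrite rmorphB rmorphXn /= -ye.
exact/esym/Fp_comb_AS_equation.
Qed.

Lemma AS_independent_card_gal : (p ^ n <= #|'Gal({:E} / 1%AS)%g|)%N.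
Proof.
have p_pr := pcharf_prime pcharK.
rewrite -[n]mul1n -(card_Fp p_pr) -card_mx -cardsT.
rewrite -(@Fp_closed_subset_full _ _ (gal_shift @: 'Gal({:E} / 1%AS)%g)) //.
- exact: leq_imset_card.
- by rewrite -gal_shift1 imset_f.
- move=> _ _ /imsetP[s sG ->] /imsetP[t tG ->].
  by rewrite -gal_shiftM imset_f ?groupM.
move=> e /gal_shift_separates[s sG sep].
by exists (gal_shift s); rewrite ?imset_f.
Qed.

End ArtinSchreierGalois.

Section AlgebraIsField.
Variables (K : fieldType) (p : nat) (pcharK : p \in [pchar K]).
Variables (n : nat) (f : 'I_n.+1 -> K).
Hypotheses (f_moore : moore p f != 0) (f_indep : AS_independent p f).

Lemma irreducible_factor_eqp_AS_Q g :
  irreducible_poly g -> g %| AS_Q p f -> g %= AS_Q p f.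
Proof.
move=> irr_g gQ; have cof_moore := moore_cofactor_moore_neq0 pcharK f_moore.
have := affine_poly_galois pcharK (k := moore p f ^+ (p ^ n)) cof_moore irr_g.
rewrite -AS_Q_affine // => /(_ gQ)[E [x [gx _ galE cardE]]].
have Qx : horner_alg x (AS_Q p f) = 0.
  by have /dvdpP[r ->] := gQ; rewrite rmorphM /= gx mulr0.
have w_minpoly := AS_w_minpoly pcharK f_moore.
have [phi _] := gen_alg_lift (gen_AS_w f_moore) w_minpoly Qx.
pose y := phi \o AS_gen pcharK f.
have := AS_independent_card_gal pcharK galE f_indep (y := y).
rewrite cardE => le_g; rewrite -dvdp_size_eqp // eqn_leq size_AS_Q //.
have Q_neq0 : AS_Q p f != 0 by rewrite monic_neq0 ?monic_AS_Q.
have := dvdp_leq Q_neq0 gQ; rewrite size_AS_Q // => -> /=.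
have g_gt0 : (0 < size g)%N by rewrite size_poly_gt0 irredp_neq0.
rewrite -(prednK g_gt0) ltnS le_g // => j.
by rewrite /y /= -rmorphXn -rmorphB /= AS_gen_equation rmorph_alg.
Qed.

Lemma irreducible_AS_Q : irreducible_poly (AS_Q p f).
Proof.
have Q_neq0 : AS_Q p f != 0 by rewrite monic_neq0 ?monic_AS_Q.
split=> [|q q_neq1 qQ].
  by rewrite size_AS_Q // ltnS expn_gt0 prime_gt0 ?(pcharf_prime pcharK).
have q_neq0 : q != 0 by apply: contraTneq qQ => ->; rewrite dvd0p.
have [|g irr_g gq] := @irreducible_factor _ q.
  by rewrite ltn_neqAle eq_sym q_neq1 size_poly_gt0.
have /andP[_ Qg] := irreducible_factor_eqp_AS_Q irr_g (dvdp_trans gq qQ).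
by rewrite /eqp qQ (dvdp_trans Qg).
Qed.

Lemma AS_alg_is_field : is_field (AS_alg pcharK f).
Proof.
exact: irreducible_minpoly_is_field irreducible_AS_Q
  (AS_w_minpoly pcharK f_moore) (gen_AS_w f_moore).
Qed.

End AlgebraIsField.

Section FieldCase.
Variables (K : fieldType) (p : nat) (pcharK : p \in [pchar K]).
Variables (n : nat) (f : 'I_n -> K).
Local Notation A := (AS_alg pcharK f).
Local Notation pcharA := (AS_alg_pchar pcharK f).
Local Notation w_ eps := (Fp_comb eps (AS_gen pcharK f)).
Hypothesis A_field : is_field A.
Let A_domain := is_field_domain A_field.

Lemma field_Kaut_AS_shift (s : A -> A) :
  is_Kaut s -> exists a, s =1 AS_shift pcharK f a.
Proof.
case=> _ [phi sphi].
have /choice[c cP] k : exists c : 'F_p,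
    phi (AS_gen pcharK f k) = AS_gen pcharK f k + natrFp pcharA c.
  apply: AS_root_translate => //.
  by rewrite AS_gen_equation -rmorphXn -rmorphB /= AS_gen_equation rmorph_alg.
exists (\row_k c k) => x; rewrite sphi; apply: AS_lrmorph_ext => k.
by rewrite AS_shift_gen mxE cP.
Qed.

Lemma field_AS_independent : AS_independent p f.
Proof.
move=> eps [x fE].
have [|c cE] := AS_root_translate pcharA (x := x%:A) (y := w_ eps) A_domain.
  by rewrite AS_comb_equation fE scalerBl exprZn expr1n.
apply/eqP; apply: contraT => /(dot_row_surj 1)[a a1].
have := AS_shift_comb pcharK f a eps; rewrite a1 rmorph1 {1}cE.
rewrite rmorphD /= rmorph_alg (rmorph_natrFp _ _ pcharA) -cE => /eqP.
by rewrite -subr_eq0 opprD addNKr oppr_eq0 oner_eq0.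
Qed.

End FieldCase.

(** * Cyclic extensions of degree [p] *)

Lemma sum_cycle (gT : finGroupType) (V : nmodType) (x : gT) (F : gT -> V) :
  \sum_(y in <[x]>%g) F y = \sum_(i < #[x]%g) F (x ^+ i)%g.
Proof.
have -> : <[x]>%g = [set (x ^+ (i : nat))%g | i : 'I_#[x]%g].
  apply/setP=> y; apply/cycleP/imsetP => [[m ->]|[i _ ->]]; last by exists i.
  by exists (Ordinal (ltn_pmod m (order_gt0 x))); rewrite //= expg_mod_order.
rewrite big_imset // => i j _ _ /eqP; rewrite eq_expg_mod_order !modn_small //.
by move/eqP/val_inj.
Qed.

Lemma sum_ordS_periodic (V : zmodType) (F : nat -> V) m :
  F m = F 0%N -> \sum_(i < m) F i.+1 = \sum_(i < m) F i.
Proof.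
move=> Fm; apply: (addrI (F 0%N)).
transitivity (\sum_(i < m.+1) F i); first by rewrite big_ord_recl.
by rewrite big_ord_recr /= Fm addrC.
Qed.

Section CyclicGalois.
Variables (K : fieldType) (p : nat) (pcharK : p \in [pchar K]).
Variables (E : splittingFieldType K) (x : gal_of {:E}).
Hypotheses (galE : galois 1%AS {:E}) (genE : 'Gal({:E} / 1%AS)%g = <[x]>%g).
Hypothesis card_gal : #|'Gal({:E} / 1%AS)%g| = p.

Lemma gal_cycle_fixed (a : E) : x a = a -> exists k, a = k%:A.
Proof.
move=> xa; apply: galois_fixed_base => // y; rewrite genE => /cycleP[m ->].
by elim: m => [|m IHm]; rewrite ?gal_id // expgSr galM ?memvf // IHm.
Qed.

(* Additive form of Hilbert 90: if [t], the sum of the [x ^+ i] applied to [d],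
   is not zero, the weighted sum [b] of the [i * (x ^+ i) d] satisfies
   [x b = b - t]. *)
Lemma additive_Hilbert90 : exists y : E, x y = y + 1.
Proof.
have order_x : #[x]%g = p by rewrite -card_gal genE.
have [d _] := gal_independent_contra (P := fun y => y \in 'Gal({:E} / 1%AS)%g)
  (c_ := fun=> 1) (group1 _) (oner_neq0 E).
rewrite genE; under eq_bigr do rewrite mul1r.
rewrite sum_cycle order_x; set t := \sum_(i < p) _ => t_neq0.
have x_expg i : x ((x ^+ i)%g d) = (x ^+ i.+1)%g d.
  by rewrite expgSr galM ?memvf.
have x_p : (x ^+ p)%g d = (x ^+ 0)%g d by rewrite -order_x expg_order expg0.
have xt : x t = t.
  rewrite rmorph_sum; under eq_bigr do rewrite /= x_expg.
  exact: (sum_ordS_periodic (F := fun i => (x ^+ i)%g d)).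
pose b := \sum_(i < p) (x ^+ i)%g d *+ i.
have xb : x b + t = b.
  rewrite -xt /t !rmorph_sum -big_split /=.
  under eq_bigr do rewrite rmorphMn /= x_expg -mulrSr.
  apply: (sum_ordS_periodic (F := fun i => (x ^+ i)%g d *+ i)).
  by rewrite -mulr_natr (GRing.pcharf0 (R := E)) ?pchar_lalg // mulr0 mulr0n.
exists (- b / t); rewrite rmorphM rmorphN fmorphV /= xt -(divff t_neq0) -mulrDl.
by rewrite -[in RHS]xb opprD subrK.
Qed.

Lemma cyclic_AS_generator :
  exists (y : E) (k : K), y ^+ p - y = k%:A /\ forall l, y != l%:A.
Proof.
have [y xy] := additive_Hilbert90.
have pcharE : p \in [pchar E] by rewrite pchar_lalg.
have [|k yk] := @gal_cycle_fixed (y ^+ p - y).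
  rewrite rmorphB rmorphXn /= xy AS_operatorD // expr1n.
  by rewrite subrr addr0.
exists y, k; split=> // l; apply: contraTneq (oner_neq0 E) => yl.
by rewrite negbK -(addKr y 1) -xy yl rmorph_alg addNr.
Qed.

End CyclicGalois.

Lemma gen_alg_prime_dim (K : fieldType) (E : fieldExtType K) (y : E) :
  prime (\dim {:E}) -> (forall l, y != l%:A) -> forall b, gen_alg y b.
Proof.
move=> dim_prime y_notin; apply: gen_alg_adjoin; apply/eqP.
rewrite -(dimv_leqif_eq (subvf _)).2.
have : (\dim <<1%AS; y>>%AS %| \dim {:E})%N.
  by rewrite [X in (_ %| X)%N](dim_sup_field (subvf <<1%AS; y>>%AS)) dvdn_mull.
case/primeP: dim_prime => _ /[apply] /orP[/eqP dim1|//].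
have : (1%VS == <<1; y>>%VS).
  by rewrite -(dimv_leqif_eq (subv_adjoin _ _)).2 dimv1 dim1.
move/eqP=> adj1; have /vlineP[l yl] : y \in 1%VS by rewrite adj1 memv_adjoin.
by have := y_notin l; rewrite yl eqxx.
Qed.

Lemma eq_is_pcyclic_ext (K : fieldType) (A : comAlgType K) p
    (V V' : A -> Prop) :
  (forall a, V a <-> V' a) -> is_pcyclic_ext p V -> is_pcyclic_ext p V'.
Proof.
move=> VV' [E [phi [Vphi galE cycE cardE]]]; exists E, phi; split=> // a.
by rewrite -VV'.
Qed.

Lemma pcyclic_ext_AS_generator (K : fieldType) (A : comAlgType K) (p : nat)
    (V : A -> Prop) : p \in [pchar K] -> is_pcyclic_ext p V ->
  exists (y : A) (k : K), [/\ y ^+ p - y = k%:A, forall l, y != l%:A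
                            & forall a, V a <-> gen_alg y a].
Proof.
move=> pcharK [E [phi [Vphi galE /cyclicP[x genE] cardE]]].
have [y [k [yk y_notin]]] := cyclic_AS_generator pcharK galE genE cardE.
have dimE : \dim {:E} = p by rewrite -cardE -galois_dim // dimv1 divn1.
have gen_y : forall b, gen_alg y b.
  by apply: gen_alg_prime_dim => //; rewrite dimE (pcharf_prime pcharK).
exists (phi y), k; split=> [|l|a].
- by rewrite -rmorphXn -rmorphB /= yk rmorph_alg.
- by rewrite -(rmorph_alg phi) (inj_eq (fmorph_inj phi)).
rewrite Vphi; split=> [[b ->]|[g ->]].
  by have [g ->] := gen_y b; exists g; rewrite lrmorph_horner_alg.
by exists (horner_alg y g); rewrite lrmorph_horner_alg.
Qed.

Section PcyclicSubextensions.
Variables (K : fieldType) (p : nat) (pcharK : p \in [pchar K]).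
Variables (n : nat) (f : 'I_n.+1 -> K).
Local Notation A := (AS_alg pcharK f).
Local Notation pcharA := (AS_alg_pchar pcharK f).
Local Notation w_ eps := (Fp_comb eps (AS_gen pcharK f)).
Hypotheses (f_moore : moore p f != 0) (A_field : is_field A).
Implicit Types e eps : 'rV['F_p]_n.+1.

Lemma is_pcyclic_ext_gen_alg eps :
  eps != 0 -> is_pcyclic_ext p (gen_alg (w_ eps)).
Proof.
move=> eps_neq0; have p_pr := pcharf_prime pcharK.
have min_w := AS_comb_minpoly pcharK f eps_neq0.
have size_h := size_AS_poly pcharK (Fp_comb eps f).
set h := _ - _ in min_w size_h; have irr_h : irreducible_poly h.
  apply: minpoly_irreducible min_w; first exact: is_field_domain.
  by rewrite size_h ltnS prime_gt0.
have := affine_poly_galois pcharK (moore1_neq0 K p) irr_h (k := Fp_comb eps f).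
rewrite -AS_poly_affine // dvdpp => /(_ isT)[E [x [hx gen_x galE]]].
rewrite size_h => cardE; have h_minpoly := irreducible_minpoly irr_h hx.
have [phi [_ phiP _]] := gen_alg_iso gen_x h_minpoly min_w.
by exists E, phi; split=> //; apply: prime_cyclic; rewrite cardE.
Qed.

(* Kummer-type argument: the shifts move [y] by a linear functional, which is
   realised by some [w_ eps]. *)
Lemma AS_root_comb (y : A) k : y ^+ p - y = k%:A ->
  exists eps l, y = w_ eps + l%:A.
Proof.
move=> yk; have /choice[c cP] a :
    exists c : 'F_p, AS_shift pcharK f a y = y + natrFp pcharA c.
  apply: AS_root_translate; first exact: is_field_domain.
  by rewrite -rmorphXn -rmorphB /= yk rmorph_alg.
have [a b | eps epsE] := @Fp_additive_dot_row p n.+1 c.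
  apply: (fmorph_inj (natrFp pcharA)); apply: (addrI y).
  rewrite -cP AS_shiftD /= cP rmorphD /= cP rmorphD.
  by rewrite (rmorph_natrFp _ _ pcharA) addrA.
have [a | l lE] := @AS_shift_fixed _ _ pcharK _ _ f_moore (y - w_ eps).
  by rewrite rmorphB /= cP AS_shift_comb epsE opprD addrACA subrr addr0.
by exists eps, l; rewrite -lE addrC subrK.
Qed.

Lemma pcyclic_ext_gen_alg (V : A -> Prop) : is_pcyclic_ext p V ->
  exists2 eps : 'rV['F_p]_n.+1, eps != 0 & forall a, V a <-> gen_alg (w_ eps) a.
Proof.
case/(pcyclic_ext_AS_generator pcharK)=> y [k [yk y_notin Vy]].
have [eps [l yE]] := AS_root_comb yk.
exists eps => [|a]; last by rewrite Vy yE gen_algD.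
apply: contraNneq (y_notin l) => eps0.
by rewrite yE eps0 (Fp_comb0 pcharA) add0r.
Qed.

Lemma pcyclic_ext_reps (R : {set 'rV['F_p]_n.+1}) (V : A -> Prop) :
    proj_reps R ->
  (exists2 eps : 'rV['F_p]_n.+1,
     eps \in R & forall a, V a <-> gen_alg (w_ eps) a) <->
  is_pcyclic_ext p V.
Proof.
move=> [R0 R_reps]; split=> [[eps epsR VE]|].
  apply: (@eq_is_pcyclic_ext _ _ _ (gen_alg (w_ eps))) => [a|].
    by rewrite VE.
  by apply: is_pcyclic_ext_gen_alg; apply: contraNneq R0 => <-.
case/pcyclic_ext_gen_alg=> eps eps_neq0 VE.
have [e [[eR [c c_neq0 epsE]] _]] := R_reps _ eps_neq0.
by exists e => // a; rewrite VE epsE gen_alg_AS_combZ.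
Qed.

End PcyclicSubextensions.

(** * Representatives of projective space *)

Section ProjectiveRepresentatives.
Variables (p n : nat) (p_pr : prime p).
Implicit Types (v e : 'rV['F_p]_n) (R : {set 'rV['F_p]_n}).

Lemma proj_reps_exists : exists R, proj_reps R.
Proof.
pose normalize v :=
  if [pick k | v 0 k != 0] is Some k then (v 0 k)^-1 *: v else v.
have normalizeZ c v : c != 0 -> normalize (c *: v) = normalize v.
  move=> c_neq0; rewrite /normalize.
  rewrite (@eq_pick _ _ (fun k => v 0 k != 0)) => [|k /=]; last first.
    by rewrite mxE mulf_eq0 negb_or c_neq0.
  case: pickP => [k vk|v0].
    by rewrite mxE scalerA invfM mulrAC mulVf // mul1r.
  suff -> : v = 0 by rewrite scaler0.
  by apply/rowP => k; have /negbFE/eqP := v0 k; rewrite mxE.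
have normalizeP v : v != 0 -> exists2 c, c != 0 & v = c *: normalize v.
  case/rV0Pn=> k0 vk0; rewrite /normalize; case: pickP => [k vk|/(_ k0)].
    by exists (v 0 k) => //; rewrite scalerA mulfV ?scale1r.
  by rewrite vk0.
exists [set v | (v != 0) && (normalize v == v)].
split=> [|v v_neq0]; first by rewrite inE eqxx.
have [c c_neq0 vE] := normalizeP v v_neq0.
exists (normalize v); split; last first.
  by move=> e [] /[!inE] /andP[_ /eqP eE] [d d_neq0 ->]; rewrite normalizeZ.
split; last by exists c.
rewrite inE -(normalizeZ c (normalize v)) // -vE eqxx andbT.
by apply: contraNneq v_neq0 => v0; rewrite vE v0 scaler0.
Qed.

Lemma proj_reps_neq0 R e : proj_reps R -> e \in R -> e != 0.
Proof. by case=> R0 _; apply: contraTneq => ->. Qed.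

Lemma proj_reps_eq R e e' c : proj_reps R -> e \in R -> e' \in R ->
  c != 0 -> e = c *: e' -> e = e'.
Proof.
move=> R_reps eR e'R c_neq0 eE; have [_ R_uniq] := R_reps.
have [r [_ rU]] := R_uniq e (proj_reps_neq0 R_reps eR).
rewrite -(rU e); first by apply: rU; split=> //; exists c.
by split=> //; exists 1; rewrite ?oner_neq0 ?scale1r.
Qed.

Lemma card_proj_reps R : proj_reps R -> #|R| = ((p ^ n - 1) %/ (p - 1))%N.
Proof.
move=> R_reps; have [_ R_spans] := R_reps.
have card_units : #|[set~ (0 : 'F_p)]| = (p - 1)%N.
  by rewrite cardsC1 card_Fp // subn1.
have scale_inj :
    {in setX [set~ (0 : 'F_p)] R &, injective (fun x => x.1 *: x.2)}.
  move=> [c e] [d e'] /[!inE] /= /andP[c0 eR] /andP[d0 e'R] ce.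
  have eE : e = (c^-1 * d) *: e' by rewrite -scalerA -ce scalerK.
  have c'd0 : c^-1 * d != 0 by rewrite mulf_neq0 ?invr_eq0.
  have ee' := proj_reps_eq R_reps eR e'R c'd0 eE; rewrite -ee' in ce *.
  congr (_, _); have /rV0Pn[k ek] := proj_reps_neq0 R_reps eR.
  by have /rowP/(_ k) := ce; rewrite !mxE => /(mulIf ek).
have : #|(fun x => x.1 *: x.2) @: setX [set~ (0 : 'F_p)] R| = (p ^ n - 1)%N.
  rewrite (_ : _ @: _ = [set~ (0 : 'rV['F_p]_n)]).
    by rewrite cardsC1 card_mx card_Fp // mul1n subn1.
  apply/setP=> v; rewrite !inE; apply/imsetP/idP => [[[c e]]|v0].
    rewrite !inE /= => /andP[c0 eR] ->.
    by rewrite scaler_eq0 negb_or c0 (proj_reps_neq0 R_reps).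
  have [e [[eR [c c0 vE]] _]] := R_spans v v0; exists (c, e) => //.
  by rewrite !inE c0.
rewrite card_in_imset // cardsX card_units => <-.
by rewrite mulKn // subn_gt0 prime_gt1.
Qed.

End ProjectiveRepresentatives.

(** * The automorphisms [sigma z] *)

Section Automorphisms.
Variables (K : fieldType) (p : nat) (pcharK : p \in [pchar K]).
Variables (n : nat) (f : 'I_n.+1 -> K).
Let p_pr := pcharf_prime pcharK.
Local Notation cof := (moore_cofactor p f).
Local Notation A := (AS_alg pcharK f).
Local Notation w := (AS_w pcharK f).
Local Notation w_ eps := (Fp_comb eps (AS_gen pcharK f)).
Local Notation shift := (AS_shift pcharK f).
Local Notation Z := (Fp_span p (hat_moore p f)).
Hypothesis f_moore : moore p f != 0.

Lemma hat_moore_spanP z :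
  reflect (exists a : 'rV['F_p]_n.+1, z = Fp_comb a cof) (z \in Z).
Proof. by rewrite -Fp_span_moore_cofactor //; apply: Fp_spanP. Qed.

(* Outside [Z] the value is irrelevant; it is the identity. *)
Definition AS_sigma (z : K) : {lrmorphism A -> A} :=
  shift (odflt 0 [pick a : 'rV['F_p]_n.+1 | Fp_comb a cof == z]).

Lemma AS_sigma_comb a : AS_sigma (Fp_comb a cof) = shift a.
Proof.
have cof_moore := moore_cofactor_moore_neq0 pcharK f_moore.
have cof_inj := moore_neq0_inj pcharK cof_moore.
rewrite /AS_sigma; case: pickP => [b /eqP/cof_inj ->//|/(_ a)].
by rewrite eqxx.
Qed.

Lemma is_Kaut_AS_sigma z : z \in Z -> is_Kaut (AS_sigma z).
Proof.
by case/hat_moore_spanP=> a ->; rewrite AS_sigma_comb; apply: is_Kaut_AS_shift.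
Qed.

Lemma AS_sigma_horner z g : z \in Z ->
  AS_sigma z (horner_alg w g) = horner_alg w (g \Po ('X + z%:P)).
Proof.
case/hat_moore_spanP=> a ->; rewrite AS_sigma_comb.
exact/horner_alg_translate/AS_shift_w.
Qed.

Lemma AS_sigmaD z z' : z \in Z -> z' \in Z ->
  AS_sigma (z + z') =1 AS_sigma z \o AS_sigma z'.
Proof.
case/hat_moore_spanP=> a -> /hat_moore_spanP[b ->].
by rewrite -(Fp_combD pcharK) !AS_sigma_comb; apply: AS_shiftD.
Qed.

Lemma AS_sigma_inj z z' : z \in Z -> z' \in Z ->
  AS_sigma z =1 AS_sigma z' -> z = z'.
Proof.
case/hat_moore_spanP=> a -> /hat_moore_spanP[b ->].
by rewrite !AS_sigma_comb => /AS_shift_inj ->.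
Qed.

Definition AS_group (s : A -> A) : Prop := exists2 z, z \in Z & s =1 AS_sigma z.

Lemma AS_groupP s : AS_group s <-> exists a, s =1 shift a.
Proof.
split=> [[_ /hat_moore_spanP[a ->]]|[a sa]].
  by rewrite AS_sigma_comb; exists a.
exists (Fp_comb a cof); first by apply/hat_moore_spanP; exists a.
by rewrite AS_sigma_comb.
Qed.

Lemma AS_group_subgroup : is_Kaut_subgroup AS_group.
Proof.
split=> [s [z zZ sz]||s t /AS_groupP[a sa] /AS_groupP[b tb]|].
- have [bij_z [phi phiE]] := is_Kaut_AS_sigma zZ.
  by split; [apply: eq_bij bij_z _ (fsym sz) | exists phi => x; rewrite sz].
- by apply/AS_groupP; exists 0 => x; rewrite AS_shift0.
- by apply/AS_groupP; exists (a + b) => x; rewrite AS_shiftD /= sa tb.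
move=> s t /AS_groupP[a sa] sK tK; apply/AS_groupP; exists (- a) => x.
by apply: (can_inj sK); rewrite tK sa AS_shiftNK.
Qed.

Lemma AS_group_iso : iso_Zp_pow p n.+1 AS_group.
Proof.
rewrite /iso_Zp_pow -(Fp_Zcast p_pr); exists shift; split.
- exact: AS_groupP.
- exact: AS_shiftD.
- exact: AS_shift_inj.
Qed.

Lemma AS_sigma_elkies (L : closedFieldType) (iota : {rmorphism K -> L}) z u
    (eps : 'rV['F_p]_n.+1) :
  z \in Z -> iota z = iota (moore p f) * closed_root p (iota u) ->
  exists2 e : 'F_p, (e : nat)%:R = elkies p f iota (Fp_comb eps f) u &
    AS_sigma z (w_ eps) = w_ eps + (-1) ^+ n * (e : nat)%:R.
Proof.
case/hat_moore_spanP=> a ->{z} zE; exists ((-1) ^+ n * dot_row a eps).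
  suff -> : u = Fp_comb a (moore_dual p f) ^+ p by rewrite (elkiesE pcharK).
  apply: (fmorph_inj iota).
  rewrite -Fp_comb_moore_dual rmorphXn fmorph_div /= zE.
  by rewrite mulrAC mulfV ?fmorph_eq0 // mul1r closed_rootK ?prime_gt0.
rewrite AS_sigma_comb AS_shift_comb.
by rewrite -/(natrFp (AS_alg_pchar pcharK f) _) rmorphM rmorph_sign signrMK.
Qed.

Lemma AS_group_full_iff_independent :
  AS_independent p f <-> is_field A /\ forall s, is_Kaut s -> AS_group s.
Proof.
split=> [f_indep|[A_field _]]; last exact: field_AS_independent A_field.
have A_field : is_field A by apply: AS_alg_is_field.
by split=> // s /(field_Kaut_AS_shift A_field); apply: (AS_groupP s).2.
Qed.

Lemma has_card_pcyclic_ext : is_field A ->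
  has_card (@is_pcyclic_ext K A p) ((p ^ n.+1 - 1) %/ (p - 1)).
Proof.
move=> A_field; have [R R_reps] := @proj_reps_exists p n.+1.
have R_neq0 e : e \in R -> e != 0 by apply: proj_reps_neq0.
rewrite -(card_proj_reps p_pr R_reps).
exists (fun i a => gen_alg (w_ (enum_val i)) a); split=> [i|V].
  by apply: is_pcyclic_ext_gen_alg => //; rewrite R_neq0 ?enum_valP.
move=> /(pcyclic_ext_reps f_moore A_field V R_reps)[e eR VE].
exists (enum_rank_in eR e); split=> [|i iE]; first by rewrite enum_rankK_in.
apply: enum_val_inj; rewrite enum_rankK_in //.
have [||c eiE] := @gen_alg_AS_comb_proportional _ _ pcharK _ f (enum_val i) e.
- by rewrite R_neq0 ?enum_valP.
- by apply/iE/VE/gen_alg_self.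
apply: (proj_reps_eq R_reps eR (enum_valP i) _ eiE).
by apply: contraNneq (R_neq0 e eR) => c0; rewrite eiE c0 scale0r.
Qed.

End Automorphisms.

Theorem corollary5p1 (K : fieldType) (p : nat) (pcharK : p \in [pchar K])
    (n : nat) (n_gt0 : (0 < n)%N) (f : 'I_n -> K)
    (f_moore : moore p f != 0) :
  let A := AS_alg pcharK f in
  let w := AS_w pcharK f in
  let w_ := fun eps : 'rV['F_p]_n => Fp_comb eps (AS_gen pcharK f) in
  let f_ := fun eps : 'rV['F_p]_n => Fp_comb eps f in
  let Z := Fp_span p (hat_moore p f) in
  let U := spaceU p f in
  [/\ (* A = K[w] ~ K[W]/(Q), w corresponding to the class of W *)
      (forall a : A, gen_alg w a) /\ quot_iso (AS_Q p f) (fun _ : A => True) w,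
      (* the sums defining F and Z are direct *)
      injective (fun eps : 'rV['F_p]_n => Fp_comb eps f) /\
      injective (fun eps : 'rV['F_p]_n => Fp_comb eps (hat_moore p f))
    & exists sigma : K -> {lrmorphism A -> A},
      let G := fun s : A -> A => exists2 z, z \in Z & s =1 sigma z in
      [/\ (* (1) *)
          [/\ forall z, z \in Z -> is_Kaut (sigma z) /\
                forall g : {poly K}, sigma z (horner_alg w g) =
                                     horner_alg w (g \Po ('X + z%:P)),
              forall z z', z \in Z -> z' \in Z ->
                z + z' \in Z /\ sigma (z + z') =1 sigma z \o sigma z',
              forall z z', z \in Z -> z' \in Z -> sigma z =1 sigma z' -> z = z',
              is_Kaut_subgroup G
            & iso_Zp_pow p n G],
          (* (2) *)
          [/\ forall x, root (rev_span_poly p f) x = (x \in U),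
              forall eps : 'rV['F_p]_n, eps != 0 ->
                [/\ w_ eps ^+ p - w_ eps = (f_ eps)%:A,
                    quot_iso ('X^p - 'X - (f_ eps)%:P)
                             (gen_alg (w_ eps)) (w_ eps),
                    is_subalg (gen_alg (w_ eps))
                  & has_Kdim (gen_alg (w_ eps)) p]
            & forall (L : closedFieldType) (iota : {rmorphism K -> L}),
                is_alg_closure iota ->
                [/\ forall y : L, root (map_poly iota (rev_span_poly p f)) y ->
                      exists2 u, u \in U & y = iota u,
                    forall z, z \in Z ->
                      exists2 u, u \in U &
                        iota z = iota (moore p f) * closed_root p (iota u)
                  & forall z u, z \in Z -> u \in U ->
                      iota z = iota (moore p f) * closed_root p (iota u) ->
                      forall eps : 'rV['F_p]_n, eps != 0 ->
                      exists2 e : 'F_p,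
                        (e : nat)%:R = elkies p f iota (f_ eps) u &
                        sigma z (w_ eps) =
                          w_ eps + (-1) ^+ n.-1 * (e : nat)%:R]]
        & (* (3) *)
          forall r : nat,
            has_Fp_quot_dim p
              (fun x => exists eps : 'rV['F_p]_n, AS_image p (x - f_ eps))
              (AS_image p) r ->
            (r = n <-> is_field A /\ forall s : A -> A, is_Kaut s -> G s) /\
            (r = n ->
              has_card (@is_pcyclic_ext K A p) ((p ^ n - 1) %/ (p - 1)) /\
              forall E : {set 'rV['F_p]_n}, proj_reps E ->
                forall V : A -> Prop,
                  (exists2 eps, eps \in E &
                     forall a, V a <-> gen_alg (w_ eps) a) <->
                  is_pcyclic_ext p V)]].
Proof.
move=> A w w_ f_ Z U.
case: n n_gt0 f f_moore @A @w @w_ @f_ @Z @U => // n _ f f_moore A w w_ f_ Z U.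
split.
- by split; [exact: gen_AS_w | exact: quot_iso_AS_w].
- split; apply: (moore_neq0_inj pcharK) => //; exact: hat_moore_moore_neq0.
exists (AS_sigma pcharK f); split.
- split; [|by split; [exact: Fp_spanD | exact: AS_sigmaD]| | |].
  + move=> z zZ; split=> [|g]; [exact: is_Kaut_AS_sigma |].
    exact: AS_sigma_horner.
  + exact: AS_sigma_inj.
  + exact: AS_group_subgroup.
  + exact: AS_group_iso.
- split=> [|eps /AS_comb_gen_alg//|L iota _]; first exact: root_rev_span_poly.
  split; [exact: root_map_rev_span_poly | exact: spaceU_closed_root |].
  by move=> z u zZ _ zE eps _; apply: AS_sigma_elkies.
move=> r /(Fp_quot_dim_independent pcharK) ->.
split=> [|f_indep]; first exact: AS_group_full_iff_independent.
have A_field : is_field A by apply: AS_alg_is_field.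
split=> [|R R_reps V]; first exact: has_card_pcyclic_ext.
exact: pcyclic_ext_reps.
Qed.
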